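(* Let $n\ge 1$, let $\alpha_j,p_j,\beta_j,q_j,w_j^{(1)},w_j^{(2)}>0$ for $1\le j\le n$, let $X_1,\dots,X_n,Y_1,\dots,Y_n$ be independent random variables with $X_j\sim Ga(\alpha_j,p_j)$ and $Y_j\sim Ga(\beta_j,q_j)$, and let $T_n=\sum_{j=1}^n(w_j^{(1)}X_j-w_j^{(2)}Y_j)$. Then $$\mathbb{E}\Big(T_nf(T_n)-\int_{\mathbb{R}}u f(T_n+u)\,\nu_{T_n}(du)\Big)=0\qquad\text{for all } f\in\mathcal{S}(\mathbb{R}),$$ where $$\nu_{T_n}(du)=\frac1u\sum_{j=1}^n\Big(p_je^{-\alpha_ju/w_j^{(1)}}\mathbf 1_{(0,\infty)}(u)-q_je^{-\beta_j|u|/w_j^{(2)}}\mathbf 1_{(-\infty,0)}(u)\Big)du.$$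
   Context: $Ga(a,s)$ ($a,s>0$) is the gamma distribution with rate $a$ and shape $s$, i.e. with characteristic function $z\mapsto(1-iz/a)^{-s}$. $\mathcal{S}(\mathbb{R})$ is the Schwartz space of smooth functions $f$ on $\mathbb{R}$ with $\lim_{|x|\to\infty}|x^mf^{(k)}(x)|=0$ for all $m,k\in\{0,1,2,\dots\}$. The measure $\nu_{T_n}$ is the Lévy measure of $T_n$. *)

(* Defs.v *)
From HB Require Import structures.
From mathcomp Require Import all_boot all_order all_algebra.
From mathcomp Require Import all_classical all_reals all_analysis.
From mathcomp Require Import complex.
Set Implicit Arguments.
Unset Strict Implicit.
Unset Printing Implicit Defensive.
Import Order.TTheory GRing.Theory Num.Theory.
Import numFieldNormedType.Exports.
Local Open Scope classical_set_scope.
Local Open Scope ring_scope.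
Local Open Scope complex_scope.

Section complex_functions.
Context {R : realType}.
Implicit Types z w : R[i].

Definition cexp z : R[i] :=
  (expR (complex.Re z) * cos (complex.Im z))
    +i* (expR (complex.Re z) * sin (complex.Im z)).

(* Principal logarithm; the formula for the argument is the principal one only
   on the half-plane Re w > 0, where all the uses below take place. *)
Definition clog w : R[i] :=
  ln (Num.sqrt (complex.Re w ^+ 2 + complex.Im w ^+ 2))
    +i* atan (complex.Im w / complex.Re w).

Definition cpowR w (s : R) : R[i] := cexp (s%:C * clog w).

Definition cintegral d (T : measurableType d)
    (mu : {measure set T -> \bar R}) (f : T -> R[i]) : R[i] :=
  Rintegral mu setT (fun x => complex.Re (f x))
    +i* Rintegral mu setT (fun x => complex.Im (f x)).

End complex_functions.

Section laws.
Context {d} {Omega : measurableType d} {R : realType}.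
Variable P : probability Omega R.
Implicit Type X : Omega -> R.

Definition charfun X (z : R) : R[i] :=
  cintegral P (fun w => cexp (0 +i* (z * X w))).

Definition has_gamma_law X (a s : R) : Prop :=
  forall z : R, charfun X z = cpowR (1 -i* (z / a)) (- s).

(* nu is the jump measure in the Levy-Khintchine representation of X, with
   truncation function u |-> u 1_{|u| <= 1}. *)
Definition is_levy_measure X
    (nu : {measure set (measurableTypeR R) -> \bar R}) : Prop :=
  [/\ nu [set 0] = 0%E,
      (\int[nu]_u (Num.min 1 (u ^+ 2))%:E < +oo)%E &
      exists b sigma : R, forall z : R,
        charfun X z =
        cexp (((- (sigma ^+ 2 * z ^+ 2 / 2)) +i* (b * z))
              + cintegral nu (fun u : measurableTypeR R =>
                  cexp (0 +i* (z * u)) - 1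
                  - (0 +i* (z * u * \1_(`[-1, 1] : set R) u))))].

Definition mutually_independent (I : finType) (Z : I -> Omega -> R) : Prop :=
  forall (J : {set I}) (A : I -> set (measurableTypeR R)),
    (forall i, measurable (A i)) ->
    P (\bigcap_(i in [set` J]) (Z i @^-1` A i))
      = (\prod_(i in J) P (Z i @^-1` A i))%E.

End laws.

Definition schwartz (R : realType) (f : R -> R) : Prop :=
  (forall (k : nat) (x : R), derivable (derive1n k f) x 1) /\
  (forall m k : nat,
    ((fun x : R => `|x ^+ m * derive1n k f x|) @ +oo --> (0 : R)) /\
    ((fun x : R => `|x ^+ m * derive1n k f x|) @ -oo --> (0 : R))).

Definition levy_density (R : realType) (n : nat)
    (alpha p beta q w1 w2 : 'I_n -> R) (u : R) : R :=
  u^-1 * \sum_(j < n)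
    (p j * expR (- (alpha j * u / w1 j)) * \1_(`]0, +oo[ : set R) u
     - q j * expR (- (beta j * `|u| / w2 j)) * \1_(`]-oo, 0[ : set R) u).

(* Main.v *)
Require Import Defs.
From HB Require Import structures.
From mathcomp Require Import all_boot all_order all_algebra.
From mathcomp Require Import all_classical all_reals all_analysis.
From mathcomp Require Import complex measurable_realfun lra ring.
Import Order.TTheory GRing.Theory Num.Theory.
Import numFieldNormedType.Exports.
Local Open Scope classical_set_scope.
Local Open Scope ring_scope.

(** Write T as a sum of independent c_i Z_i, where Z_i ranges over the X_j and
the Y_j, has law Ga(a_i, s_i), and c_i is w1_j or - w2_j. With the signed rate
b_i = a_i / c_i, independence and the gamma law give the characteristic function
of T in polar form, phi(z) = exp(A(z) + i B(z)), where
  A(z) = - sum_i s_i log sqrt(1 + (z/b_i)^2),  B(z) = sum_i s_i atan(z/b_i)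
([Ecos_sum_Esin_sum], [gamma_law_trig]).

Let k(u) = u * levy_density(u). This is an integrable signed combination of
exponentials e^{-|b_i u|}, each living on the half-line where b_i u > 0, so its
Fourier transform is explicit ([signed_half_exp_cos], [signed_half_exp_sin]).
Comparing it with the derivatives of A and B gives the one identity from which
both claims follow:
  A'(z) = - int k(u) sin(zu) du,    B'(z) = int k(u) cos(zu) du,
that is, phi' = i phi * (Fourier transform of k).

Levy-Khintchine. Differentiating int (e^{izu} - 1) levy_density(u) du under the
integral sign gives the same derivatives, and everything vanishes at z = 0. So
A and B are the real and imaginary parts of that integral ([levy_log_modulus],
[levy_phase]); as |u| levy_density(u) is integrable, the truncated compensator
only contributes a drift.

Stein identity. If mu is the law of T, the identity for phi' says that the finite
signed measure x mu(dx) and the convolution of mu with k(u)du have the same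
Fourier transform, so the integrals of a bounded continuous integrable function
against them agree
([fourier_uniqueness]): the Poisson kernel e / (e^2 + x^2) is the cosine transform
of e^{-et} on t > 0, so by Fubini the Poisson smoothing of such a measure depends
on its Fourier transform alone, and the smoothing is removed by letting e tend
to 0. The first moment needed for x mu(dx) to be finite comes from the bound
1 - Re phi(z) = O(z^2) ([integrable_of_charfun_bound]). Schwartz functions qualify
since they are bounded by a multiple of 1 / (1 + x^2). *)

Set Implicit Arguments.
Unset Strict Implicit.
Unset Printing Implicit Defensive.

#[local] Hint Resolve cos_max sin_max : core.

(** * Measures given by a density *)

Section density.
Local Open Scope ereal_scope.
Context d (T : measurableType d) (R : realType) (mu : {measure set T -> \bar R}).
Variable h : T -> R.
Hypothesis h_ge0 : forall x, (0 <= h x)%R.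
Hypothesis mh : measurable_fun setT h.

Definition with_density (A : set T) : \bar R := \int[mu]_(x in A) (h x)%:E.

Let mhE (A : set T) : measurable_fun A (EFin \o h).
Proof. by apply/measurable_EFinP; exact: measurable_funTS. Qed.

Let density0 : with_density set0 = 0.
Proof. by rewrite /with_density integral_set0. Qed.

Let density_ge0 A : 0 <= with_density A.
Proof. by apply: integral_ge0 => x _; rewrite lee_fin. Qed.

Let density_sigma_additive : semi_sigma_additive with_density.
Proof.
move=> F mF tF mUF; rewrite /with_density ge0_integral_bigcup//.
- by apply: is_cvg_nneseries => n _ _; apply: integral_ge0 => x _; rewrite lee_fin.
- by move=> x _; rewrite lee_fin.
Qed.

HB.instance Definition _ := isMeasure.Build _ T R with_density
  density0 density_ge0 density_sigma_additive.

Import HBNNSimple.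

Let indic_ge0 (g : {nnsfun T >-> R}) (r : R) (x : T) :
  0 <= (r * \1_(g @^-1` [set r]) x)%:E.
Proof.
rewrite lee_fin; have [r0|r0] := ltP r 0%R; last by rewrite mulr_ge0.
by rewrite preimage_nnfun0// indic0 mulr0.
Qed.

Let density_nnsfun (g : {nnsfun T >-> R}) :
  \int[with_density]_x (g x)%:E = \int[mu]_x (g x * h x)%:E.
Proof.
under [LHS]eq_integral do rewrite fimfunE -fsumEFin//.
rewrite ge0_integral_fsum//=; last first.
  by move=> r; exact/measurable_EFinP/measurableT_comp.
transitivity (\int[mu]_x \sum_(r \in range g)
    ((r * \1_(g @^-1` [set r]) x)%:E * (h x)%:E)); last first.
  apply: eq_integral => x _.
  rewrite -ge0_mule_fsuml; last by move=> r; exact: indic_ge0.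
  by rewrite fsumEFin// -fimfunE.
rewrite ge0_integral_fsum//=; last 2 first.
- move=> r; apply: emeasurable_funM => //.
  exact/measurable_EFinP/measurable_funM.
- by move=> r x _; apply: mule_ge0; rewrite ?lee_fin//; exact: indic_ge0.
apply: eq_fsbigr => r _.
rewrite integralZl_indic_nnsfun//= integral_indic// setIT.
have [r0|r0] := ltP r 0%R.
  rewrite preimage_nnfun0// measure0 mule0 integral0_eq// => x _.
  by rewrite indic0 mulr0 mul0e.
under eq_integral do rewrite EFinM -muleA.
rewrite ge0_integralZl//=.
- congr (_ * _); rewrite /with_density [LHS]integral_mkcond.
  by apply: eq_integral => x _; rewrite epatch_indic muleC.
- apply: emeasurable_funM => //; exact/measurable_EFinP.
- by move=> x _; rewrite mule_ge0 ?lee_fin.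
Qed.

Let density_nonneg (g : T -> \bar R) : measurable_fun setT g -> (forall x, 0 <= g x) ->
  \int[with_density]_x g x = \int[mu]_x (g x * (h x)%:E).
Proof.
move=> mg g0; pose g_ := nnsfun_approx measurableT mg.
transitivity (limn (fun n => \int[with_density]_x (g_ n x)%:E)).
  rewrite -monotone_convergence//.
  - by apply: eq_integral => x _; apply/esym/cvg_lim => //; apply: cvg_nnsfun_approx.
  - by move=> n; exact/measurable_EFinP/measurable_funTS.
  - by move=> *; rewrite lee_fin.
  - by move=> x _ m n mn; rewrite lee_fin; exact/lefP/nd_nnsfun_approx.
under eq_fun do rewrite density_nnsfun.
rewrite -monotone_convergence//; last 3 first.
- by move=> n; apply/measurable_EFinP/measurable_funM.
- by move=> n x _; rewrite lee_fin mulr_ge0.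
- by move=> x _ m n mn; rewrite lee_fin ler_wpM2r//; exact/lefP/nd_nnsfun_approx.
apply: eq_integral => x _; apply/cvg_lim => //.
under eq_fun do rewrite EFinM.
by apply: cvgeZr => //; apply: cvg_nnsfun_approx.
Qed.

(** The positive and negative parts of g are treated separately, each by monotone
approximation with simple functions. *)
Lemma density_measure_exists : exists nu : {measure set T -> \bar R},
  (forall A, measurable A -> nu A = \int[mu]_(x in A) (h x)%:E) /\
  (forall g : T -> R, measurable_fun setT g ->
    \int[nu]_x (g x)%:E = \int[mu]_x (g x * h x)%:E).
Proof.
exists with_density; split=> // g mg.
have mgE : measurable_fun setT (EFin \o g) by exact/measurable_EFinP.
rewrite [LHS]integralE [RHS]integralE; congr (_ - _).
- rewrite density_nonneg//; last exact: measurable_funepos.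
  apply: eq_integral => x _.
  by rewrite !funeposE maxe_pMl ?mul0e ?lee_fin.
- rewrite density_nonneg//; last exact: measurable_funeneg.
  apply: eq_integral => x _.
  by rewrite !funenegE maxe_pMl ?mul0e ?lee_fin ?mulNe.
Qed.

End density.

(** * Integrability and Fubini's theorem for real-valued integrals *)

Section integrals.
Context d (T : measurableType d) (R : realType) (mu : {measure set T -> \bar R}).
Implicit Types (h g : T -> R) (C : R).

Lemma integrable_mul_bounded h g C :
  mu.-integrable setT (EFin \o h) -> measurable_fun setT g ->
  (forall x, `|g x| <= C) -> mu.-integrable setT (fun x => (h x * g x)%:E).
Proof.
move=> ih mg gC.
apply: (@integrableMl _ _ _ mu _ measurableT (EFin \o h) g ih mg).
by exists C; split; [exact: num_real|move=> y Cy x _; exact: le_trans (gC x) (ltW Cy)].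
Qed.

Lemma integrable_le h g : measurable_fun setT h ->
  (forall x, `|h x| <= g x) -> mu.-integrable setT (EFin \o g) ->
  mu.-integrable setT (EFin \o h).
Proof.
move=> mh hg; apply: le_integrable => //; first exact/measurable_EFinP.
by move=> x _; rewrite lee_fin (le_trans (hg x))// ler_norm.
Qed.

Lemma EFin_Rintegral h : mu.-integrable setT (EFin \o h) ->
  (\int[mu]_x h x)%:E = (\int[mu]_x (h x)%:E)%E.
Proof. by move=> ih; rewrite /Rintegral fineK// integrable_fin_num. Qed.

Lemma integrable_sumR (I : Type) (s : seq I) (F : I -> T -> R) :
  (forall i, mu.-integrable setT (EFin \o F i)) ->
  mu.-integrable setT (EFin \o (fun x => \sum_(i <- s) F i x)).
Proof.
move=> iF.
rewrite [X in mu.-integrable _ X](_ : _ =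
    (fun x => \sum_(i <- s) (F i x)%:E)%E).
  by apply: integrable_sum => // i _; exact: iF.
by apply/funext => x /=; rewrite sumEFin.
Qed.

Lemma Rintegral_sum (I : Type) (s : seq I) (F : I -> T -> R) :
  (forall i, mu.-integrable setT (EFin \o F i)) ->
  \int[mu]_x (\sum_(i <- s) F i x) = \sum_(i <- s) \int[mu]_x F i x.
Proof.
move=> iF; elim: s => [|i s IH].
  under eq_Rintegral do rewrite big_nil.
  by rewrite big_nil Rintegral_cst// mul0r.
under eq_Rintegral do rewrite big_cons.
rewrite RintegralD ?IH ?big_cons//; exact: integrable_sumR.
Qed.

End integrals.

(** The integrable factors are kept apart from the bounded kernel g, so that
integrability on the product space is settled once and for all. *)
Section fubini_weighted.
Context d1 d2 (T1 : measurableType d1) (T2 : measurableType d2) (R : realType).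
Variable m1 : {sigma_finite_measure set T1 -> \bar R}.
Variable m2 : {sigma_finite_measure set T2 -> \bar R}.
Variables (h : T1 -> R) (w : T2 -> R) (g : T1 * T2 -> R) (C : R).
Hypothesis ih : m1.-integrable setT (EFin \o h).
Hypothesis iw : m2.-integrable setT (EFin \o w).
Hypothesis mg : measurable_fun setT g.
Hypothesis gC : forall z, `|g z| <= C.

Let mh : measurable_fun setT h.
Proof. by apply/measurable_EFinP; exact: (measurable_int m1 ih). Qed.
Let mw : measurable_fun setT w.
Proof. by apply/measurable_EFinP; exact: (measurable_int m2 iw). Qed.

Lemma integrable_product_weight :
  (m1 \x m2)%E.-integrable setT (fun z => (h z.1 * w z.2)%:E).
Proof.
have mf : measurable_fun setT (fun z : T1 * T2 => (h z.1 * w z.2)%:E).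
  by apply/measurable_EFinP; apply: measurable_funM; exact: measurableT_comp.
apply/integrable12ltyP => //=.
under eq_integral.
  move=> x _.
  under eq_integral do rewrite normrM EFinM.
  rewrite ge0_integralZl//; last by apply/measurable_EFinP; exact: measurableT_comp.
  over.
move/integrable_abse : ih => /=; move/integrable_abse : iw => /= iw' ih'.
have /fineK <- := integrable_fin_num measurableT iw'.
rewrite integralZr//.
have /fineK <- := integrable_fin_num measurableT ih'.
by rewrite -EFinM ltry.
Qed.

Lemma integrable_product_weighted :
  (m1 \x m2)%E.-integrable setT (fun z => (h z.1 * w z.2 * g z)%:E).
Proof. exact: (integrable_mul_bounded integrable_product_weight mg gC). Qed.

Let inner x : (\int[m2]_t (h x * w t * g (x, t))%:E)%E
  = (h x * \int[m2]_t (w t * g (x, t)))%:E.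
Proof.
have i1 : m2.-integrable setT (fun t => (w t * g (x, t))%:E).
  apply: (integrable_mul_bounded iw _ (C := C)) => //.
  exact: (measurableT_comp mg).
rewrite -RintegralZl//.
rewrite EFin_Rintegral.
  by apply: eq_integral => t _; rewrite mulrA.
exact: (integrableZl measurableT (h x) i1).
Qed.

Let outer t : (\int[m1]_x (h x * w t * g (x, t))%:E)%E
  = (w t * \int[m1]_x (h x * g (x, t)))%:E.
Proof.
have i1 : m1.-integrable setT (fun x => (h x * g (x, t))%:E).
  apply: (integrable_mul_bounded ih _ (C := C)) => //.
  exact: (measurableT_comp mg).
rewrite -RintegralZl//.
rewrite EFin_Rintegral.
  by apply: eq_integral => x _; rewrite mulrA (mulrC (w t)).
exact: (integrableZl measurableT (w t) i1).
Qed.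

Lemma Fubini_weighted1 :
  \int[(m1 \x m2)%E]_z (h z.1 * w z.2 * g z) =
  \int[m1]_x (h x * \int[m2]_t (w t * g (x, t))).
Proof.
rewrite /Rintegral -integral12_prod_meas1; last exact: integrable_product_weighted.
by congr fine; apply: eq_integral => x _; exact: inner.
Qed.

Lemma integrable_Fubini_weighted1 :
  m1.-integrable setT (fun x => (h x * \int[m2]_t (w t * g (x, t)))%:E).
Proof.
have := integrable_fubini_F integrable_product_weighted.
by congr (_.-integrable _ _); apply/funext => x; exact: inner.
Qed.

Lemma Fubini_weighted :
  \int[m1]_x (h x * \int[m2]_t (w t * g (x, t))) =
  \int[m2]_t (w t * \int[m1]_x (h x * g (x, t))).
Proof.
rewrite -Fubini_weighted1.
rewrite /Rintegral -integral21_prod_meas1; last exact: integrable_product_weighted.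
by congr fine; apply: eq_integral => t _; exact: outer.
Qed.

End fubini_weighted.

(** * Fourier transforms of one-sided exponentials *)

Section laplace.
Context (R : realType).
Local Notation leb := (@lebesgue_measure R).
Implicit Types (a z u : R).

Definition half_exp a u : R := expR (- (a * u)) * \1_(`]0, +oo[ : set R) u.

Lemma measurable_half_exp a : measurable_fun setT (half_exp a).
Proof.
apply: measurable_funM => //; apply: measurableT_comp => //.
by apply: measurableT_comp => //; exact: measurable_funM.
Qed.

Lemma half_exp_ge0 a u : 0 <= half_exp a u.
Proof. by rewrite /half_exp mulr_ge0 ?expR_ge0. Qed.

Lemma half_exp0 a : half_exp a 0 = 0.
Proof. by rewrite /half_exp indicE memNset ?mulr0//= in_itv/= ltxx. Qed.

Let is_derive_continuous (f f' : R -> R) :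
  (forall u, is_derive u 1 f (f' u)) -> continuous f.
Proof.
by move=> df u; apply/differentiable_continuous/derivable1_diffP; case: (df u).
Qed.

(** The derivative of e^{-au} B(u) is e^{-au} (B'(u) - a B(u)), which the
hypothesis makes e^{-au} b(u); the boundary term at infinity vanishes because B
is bounded. The sign condition on b is what the fundamental theorem of calculus
on a half-line asks for. *)
Lemma laplace_ge0 a (b B : R -> R) (C : R) : 0 < a ->
  continuous b -> (forall u, 0 <= b u) ->
  (forall u, is_derive u 1 B (b u + a * B u)) -> (forall u, `|B u| <= C) ->
  (\int[leb]_u (half_exp a u * b u)%:E = (- B 0)%:E)%E.
Proof.
move=> a0 cb b0 dB BC.
have dF u : is_derive u 1 (fun v => expR (- (a * v)) * B v) (expR (- (a * u)) * b u).
  have ? := dB u; apply: is_derive_eq.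
  by rewrite /GRing.scale/=; ring.
have cexp : continuous (fun u : R => expR (- (a * u))).
  apply: (@is_derive_continuous _ (fun u => expR (- (a * u)) * - a)) => u.
  by apply: is_derive_eq; rewrite /GRing.scale/=; ring.
have cF : continuous (fun v => expR (- (a * v)) * B v).
  exact: is_derive_continuous dF.
transitivity (\int[leb]_(u in `[0%R, +oo[) (expR (- (a * u)) * b u)%:E)%E.
  rewrite -integral_itv_obnd_cbnd; last first.
    apply/measurable_EFinP/measurable_funTS.
    apply: continuous_measurable_fun => u.
    by apply: cvgM; [exact: cexp|exact: cb].
  rewrite [RHS]integral_mkcond; apply: eq_integral => u _.
  by rewrite epatch_indic -EFinM /half_exp mulrAC.
rewrite (@ge0_continuous_FTC2y _ _ (fun v => expR (- (a * v)) * B v) 0 0) //.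
- by rewrite mulr0 oppr0 expR0 mul1r sub0e.
- by move=> u _; rewrite mulr_ge0 ?expR_ge0.
- by apply: continuous_subspaceT => u; apply: cvgM; [exact: cexp|exact: cb].
- apply: norm_cvg0.
  apply: (@squeeze_cvgr _ _ _ _ (cst 0) (fun v => C * expR (- (a * v)))).
  + near=> v; rewrite normr_ge0/= normrM ger0_norm ?expR_ge0// mulrC.
    by rewrite ler_wpM2r ?expR_ge0.
  + exact: cvg_cst.
  + rewrite -[X in _ --> X](mulr0 C); apply: cvgM; first exact: cvg_cst.
    apply: (cvg_comp (fun v => a * v) (fun v => expR (- v))); last exact: cvgr_expR.
    exact: gt0_cvgMry.
- exact: (cvg_at_right_filter (cF 0)).
- by move=> u _; rewrite derive1E; apply: derive_val.
Unshelve. all: by end_near. Qed.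

Lemma integral_half_exp a : 0 < a -> (\int[leb]_u (half_exp a u)%:E = (a^-1)%:E)%E.
Proof.
move=> a0.
transitivity (\int[leb]_u (half_exp a u * cst 1 u)%:E)%E.
  by apply: eq_integral => u _; rewrite mulr1.
have dB u : is_derive u 1 (cst (- a^-1) : R -> R) (cst 1 u + a * cst (- a^-1) u).
  by apply: is_derive_eq; rewrite /= mulrN divff ?subrr// gt_eqF.
rewrite (laplace_ge0 (C := `|a^-1|) a0 _ _ dB) ?opprK//.
- by move=> u; exact: cvg_cst.
- by move=> u; rewrite normrN.
Qed.

Lemma integrable_half_exp a : 0 < a -> leb.-integrable setT (EFin \o half_exp a).
Proof.
move=> a0; apply/integrableP; split.
  by apply/measurable_EFinP; exact: measurable_half_exp.
under eq_integral do rewrite /= ger0_norm ?half_exp_ge0//.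
by rewrite integral_half_exp// ltry.
Qed.

Lemma Rintegral_half_exp a : 0 < a -> \int[leb]_u half_exp a u = a^-1.
Proof. by move=> a0; rewrite /Rintegral integral_half_exp. Qed.

Let trig_bound (c s z a : R) : 0 < a -> `|c| <= 1 -> `|s| <= 1 ->
  `|(z * c + a * s) / (a ^+ 2 + z ^+ 2) - a^-1| <=
  (`|z| + `|a|) / (a ^+ 2 + z ^+ 2) + `|a^-1|.
Proof.
move=> a0 c1 s1; rewrite (le_trans (ler_normB _ _))// lerD2r normrM.
rewrite [X in _ * X]ger0_norm ?invr_ge0 ?addr_ge0 ?sqr_ge0//.
rewrite ler_wpM2r ?invr_ge0 ?addr_ge0 ?sqr_ge0//.
by rewrite (le_trans (ler_normD _ _))// !normrM lerD// ler_piMr.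
Qed.

Let continuous_cosM z : continuous (fun u => cos (z * u)).
Proof.
apply: (@is_derive_continuous _ (fun u => - z * sin (z * u))) => u.
by apply: is_derive_eq; rewrite /GRing.scale/=; ring.
Qed.

Let continuous_sinM z : continuous (fun u => sin (z * u)).
Proof.
apply: (@is_derive_continuous _ (fun u => z * cos (z * u))) => u.
by apply: is_derive_eq; rewrite /GRing.scale/=; ring.
Qed.

Lemma measurable_cosM z : measurable_fun setT (fun u => cos (z * u)).
Proof. exact: continuous_measurable_fun (@continuous_cosM z). Qed.

Lemma measurable_sinM z : measurable_fun setT (fun u => sin (z * u)).
Proof. exact: continuous_measurable_fun (@continuous_sinM z). Qed.

(** Shifting the cosine by 1 makes the integrand nonnegative. *)
Lemma laplace_cos a z : 0 < a ->
  \int[leb]_u (half_exp a u * cos (z * u)) = a / (a ^+ 2 + z ^+ 2).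
Proof.
move=> a0; have az0 : a ^+ 2 + z ^+ 2 != 0.
  by rewrite gt_eqF// ltr_wpDr ?sqr_ge0// exprn_gt0.
have ic : leb.-integrable setT (fun u => (half_exp a u * cos (z * u))%:E).
  exact: (integrable_mul_bounded (integrable_half_exp a0) (measurable_cosM z)).
suff : \int[leb]_u (half_exp a u * (1 + cos (z * u))) = a^-1 + a / (a ^+ 2 + z ^+ 2).
  under eq_Rintegral do rewrite mulrDr mulr1.
  rewrite RintegralD ?Rintegral_half_exp//; first by move/addrI.
  exact: integrable_half_exp.
(* e^{-au} B(u) is the antiderivative found by integrating by parts twice *)
pose B u := (z * sin (z * u) + a * - cos (z * u)) / (a ^+ 2 + z ^+ 2) - a^-1.
have dB u : is_derive u 1 B ((1 + cos (z * u)) + a * B u).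
  rewrite /B; apply: is_derive_eq; rewrite /GRing.scale/=; field.
  by rewrite az0 gt_eqF.
rewrite /Rintegral (laplace_ge0 (b := fun u => 1 + cos (z * u))
  (C := (`|z| + `|a|) / (a ^+ 2 + z ^+ 2) + `|a^-1|) a0 _ _ dB) //= ?/B.
- by rewrite mulr0 sin0 cos0; field; rewrite az0 gt_eqF.
- by move=> u; apply: cvgD; [exact: cvg_cst|exact: continuous_cosM].
- by move=> u; apply: trig_bound => //; rewrite ?normrN.
Qed.

Lemma laplace_sin a z : 0 < a ->
  \int[leb]_u (half_exp a u * sin (z * u)) = z / (a ^+ 2 + z ^+ 2).
Proof.
move=> a0; have az0 : a ^+ 2 + z ^+ 2 != 0.
  by rewrite gt_eqF// ltr_wpDr ?sqr_ge0// exprn_gt0.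
have ic : leb.-integrable setT (fun u => (half_exp a u * sin (z * u))%:E).
  exact: (integrable_mul_bounded (integrable_half_exp a0) (measurable_sinM z)).
suff : \int[leb]_u (half_exp a u * (1 + sin (z * u))) = a^-1 + z / (a ^+ 2 + z ^+ 2).
  under eq_Rintegral do rewrite mulrDr mulr1.
  rewrite RintegralD ?Rintegral_half_exp//; first by move/addrI.
  exact: integrable_half_exp.
(* e^{-au} B(u) is the antiderivative found by integrating by parts twice *)
pose B u := (z * - cos (z * u) + a * - sin (z * u)) / (a ^+ 2 + z ^+ 2) - a^-1.
have dB u : is_derive u 1 B ((1 + sin (z * u)) + a * B u).
  rewrite /B; apply: is_derive_eq; rewrite /GRing.scale/=; field.
  by rewrite az0 gt_eqF.
rewrite /Rintegral (laplace_ge0 (b := fun u => 1 + sin (z * u))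
  (C := (`|z| + `|a|) / (a ^+ 2 + z ^+ 2) + `|a^-1|) a0 _ _ dB) //= ?/B.
- by rewrite mulr0 sin0 cos0; field; rewrite az0 gt_eqF.
- by move=> u; apply: cvgD; [exact: cvg_cst|exact: continuous_sinM].
- by move=> u; apply: trig_bound => //; rewrite ?normrN.
Qed.

End laplace.

Section reflection.
Context (R : realType).
Local Notation leb := (@lebesgue_measure R).

Let mopp : measurable_fun setT (-%R : R -> R).
Proof. exact: measurable_funN. Qed.

Lemma integral_reflection (f : R -> \bar R) : measurable_fun setT f ->
  (forall x, 0 <= f x)%E -> (\int[leb]_x f (- x)%R = \int[leb]_x f x)%E.
Proof.
move=> mf f0.
rewrite -[LHS](@ge0_integral_pushforward _ _ (measurableTypeR R)
  (measurableTypeR R) R _ mopp leb setT)//.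
by apply: eq_measure_integral => A mA _; exact: lebesgue_measureN.
Qed.

Lemma integrable_reflection (f : R -> R) : leb.-integrable setT (EFin \o f) ->
  leb.-integrable setT (EFin \o (fun x => f (- x))).
Proof.
move=> /integrableP[mf fi]; apply/integrableP; split.
  exact: (measurableT_comp mf).
by rewrite (@integral_reflection (fun x => `|(f x)%:E|%E))//; exact: measurableT_comp.
Qed.

Lemma Rintegral_reflection (f : R -> R) : leb.-integrable setT (EFin \o f) ->
  \int[leb]_x f (- x) = \int[leb]_x f x.
Proof.
move=> fi; rewrite /Rintegral; congr fine.
have mf := measurable_int _ fi.
rewrite -[LHS](@integral_pushforward _ _ (measurableTypeR R)
  (measurableTypeR R) R _ mopp leb setT (EFin \o f))//.
  by apply: eq_measure_integral => A mA _; exact: lebesgue_measureN.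
exact: integrable_reflection.
Qed.

End reflection.

(** * The Poisson kernel *)

Section cauchy_fun.
Context (R : realType).
Local Notation leb := (@lebesgue_measure R).

Definition cauchy_fun (s : R) : R := (1 + s ^+ 2)^-1.

Lemma cauchy_denom_gt0 (s : R) : 0 < 1 + s ^+ 2.
Proof. by rewrite ltr_wpDr ?sqr_ge0. Qed.

Lemma cauchy_ge0 s : 0 <= cauchy_fun s.
Proof. by rewrite invr_ge0 ltW// cauchy_denom_gt0. Qed.

Lemma continuous_cauchy : continuous cauchy_fun.
Proof.
move=> s; apply: cvgV; first by rewrite gt_eqF// cauchy_denom_gt0.
by apply: cvgD; [exact: cvg_cst|exact: exprn_continuous].
Qed.

Lemma measurable_cauchy : measurable_fun setT cauchy_fun.
Proof. exact: continuous_measurable_fun continuous_cauchy. Qed.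

Let half (s : R) : R := cauchy_fun s * \1_(`[0, +oo[ : set R) s.

Let half_ge0 s : 0 <= half s.
Proof. by rewrite mulr_ge0 ?cauchy_ge0. Qed.

Let integral_half : (\int[leb]_s (half s)%:E = (pi / 2)%:E)%E.
Proof.
transitivity (\int[leb]_(s in `[0%R, +oo[) (cauchy_fun s)%:E)%E.
  by rewrite [RHS]integral_mkcond; apply: eq_integral => s _; rewrite epatch_indic.
rewrite (@ge0_continuous_FTC2y _ _ (@atan R) 0 (pi / 2)) ?atan0 ?sube0//.
- by move=> s _; exact: cauchy_ge0.
- exact/continuous_subspaceT/continuous_cauchy.
- exact: cvgy_atan.
- by rewrite -[X in _ --> X]atan0; apply/cvg_at_right_filter; exact: continuous_atan.
- by move=> s _; rewrite derive1_atan.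
Qed.

Let integrable_half : leb.-integrable setT (EFin \o half).
Proof.
apply/integrableP; split.
  by apply/measurable_EFinP; apply: measurable_funM => //; exact: measurable_cauchy.
under eq_integral do rewrite /= ger0_norm ?half_ge0//.
by rewrite integral_half ltry.
Qed.

Lemma integrable_cauchy : leb.-integrable setT (EFin \o cauchy_fun).
Proof.
apply: (@integrable_le _ (measurableTypeR R) R leb cauchy_fun
  (fun s => half s + half (- s))).
- exact: measurable_cauchy.
- move=> s; rewrite ger0_norm ?cauchy_ge0// /half /cauchy_fun sqrrN -mulrDr.
  rewrite ler_peMr ?invr_ge0 ?(ltW (cauchy_denom_gt0 _))//.
  rewrite !indicE !mem_setE !in_itv/= !andbT oppr_ge0.
  by case: (leP 0 s) => s0; case: (leP s 0) => s1 //=; rewrite ?lerDl//; lra.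
- exact: (integrableD measurableT integrable_half
    (integrable_reflection integrable_half)).
Qed.

(** Positivity allows this integral to be cancelled as a common factor. *)
Lemma Rintegral_cauchy_gt0 : 0 < \int[leb]_s cauchy_fun s.
Proof.
apply: (@lt_le_trans _ _ (\int[leb]_s half s)).
  by rewrite /Rintegral integral_half/= divr_gt0 ?pi_gt0.
apply: le_Rintegral => //; first exact: integrable_cauchy.
by move=> s _; rewrite /half ler_piMr ?cauchy_ge0.
Qed.

End cauchy_fun.

Section poisson.
Context (R : realType).
Local Notation leb := (@lebesgue_measure R).

Definition poisson (e x : R) : R := e / (e ^+ 2 + x ^+ 2).

(** The Fourier representation of the kernel: it is through this formula that
smoothing by the kernel sees only Fourier transforms. *)
Lemma poissonE (e x : R) : 0 < e ->
  poisson e x = \int[leb]_t (half_exp e t * cos (x * t)).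
Proof. by move=> e0; rewrite laplace_cos. Qed.

Lemma poisson_bound (e x : R) : 0 < e -> `|poisson e x| <= e^-1.
Proof.
move=> e0; have ex0 : 0 < e ^+ 2 + x ^+ 2 by rewrite ltr_wpDr ?sqr_ge0 ?exprn_gt0.
rewrite ger0_norm ?divr_ge0 ?(ltW e0) ?(ltW ex0)//.
rewrite ler_pdivrMr// -ler_pdivrMl ?invr_gt0// invrK -expr2 lerDl sqr_ge0//.
Qed.

Lemma continuous_poisson (e : R) : 0 < e -> continuous (poisson e).
Proof.
move=> e0 x; apply: cvgM; first exact: cvg_cst.
apply: cvgV; first by rewrite gt_eqF// ltr_wpDr ?sqr_ge0 ?exprn_gt0.
by apply: cvgD; [exact: cvg_cst|exact: exprn_continuous].
Qed.

Lemma measurable_poisson (e : R) : 0 < e -> measurable_fun setT (poisson e).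
Proof. by move=> e0; exact: continuous_measurable_fun (continuous_poisson e0). Qed.

Let poisson_smoothing_ge0 (f : R -> R) (e x : R) : 0 < e -> continuous f ->
  (forall y, 0 <= f y) ->
  (\int[leb]_y (f y * poisson e (y - x))%:E =
   \int[leb]_s (cauchy_fun s * f (x + e * s))%:E)%E.
Proof.
move=> e0 cf f0.
have dF (s : R) : is_derive s 1 (fun s => x + e * s : R) e.
  by apply: is_derive_eq; rewrite /GRing.scale/=; ring.
have dFE : derive1 (fun s => x + e * s : R) = cst e.
  by apply/funext => s; rewrite derive1E; apply: derive_val.
rewrite (@increasing_ge0_integration_by_substitutionT _ (fun s => x + e * s)).
- apply: eq_integral => s _; rewrite dFE; congr EFin.
  rewrite !fctE /= /poisson /cauchy_fun (addrC x) addrK (addrC _ x).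
  have s0 := cauchy_denom_gt0 s; field.
  rewrite (gt_eqF s0)/= gt_eqF//.
  by rewrite ltr_wpDr ?sqr_ge0 ?exprn_gt0.
- by move=> s t st; rewrite ltrD2l ltr_pM2l.
- by rewrite dFE => s; exact: cvg_cst.
- by rewrite dFE; exact: is_cvg_cst.
- by rewrite dFE; exact: is_cvg_cst.
- by move=> s; case: (dF s).
- apply: (cvg_comp (fun s => e * s) (fun s => x + s)).
    exact: gt0_cvgMrNy.
  exact: cvg_addrl_Ny.
- apply: (cvg_comp (fun s => e * s) (fun s => x + s)).
    exact: gt0_cvgMry.
  exact: cvg_addrl.
- move=> y; apply: cvgM; first exact: cf.
  apply: (@continuous_comp _ _ _ (fun y => y - x) (poisson e)).
    by apply: cvgB; [exact: cvg_id|exact: cvg_cst].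
  exact: continuous_poisson.
- by move=> y; rewrite mulr_ge0// divr_ge0 ?(ltW e0)// addr_ge0 ?sqr_ge0.
Qed.

Let integrable_cauchy_shift (f : R -> R) (C e x : R) : continuous f ->
  (forall y, `|f y| <= C) ->
  leb.-integrable setT (fun s => (cauchy_fun s * f (x + e * s))%:E).
Proof.
move=> cf fC.
have mf : measurable_fun setT (fun s => f (x + e * s)).
  apply: (measurableT_comp (continuous_measurable_fun cf)).
  by apply: measurable_funD => //; exact: measurable_funM.
exact: (integrable_mul_bounded (@integrable_cauchy R) mf (C := C)).
Qed.

(** The substitution y = x + e s. Adding the bound C to f reduces the statement
to nonnegative functions. *)
Lemma poisson_smoothing (f : R -> R) (C e x : R) : 0 < e -> continuous f ->
  (forall y, `|f y| <= C) ->
  \int[leb]_y (f y * poisson e (y - x)) = \int[leb]_s (cauchy_fun s * f (x + e * s)).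
Proof.
move=> e0 cf fC.
have C0 : 0 <= C := le_trans (normr_ge0 _) (fC 0).
have cC : continuous (cst C : R -> R) by move=> y; exact: cvg_cst.
have CC (y : R) : `|(cst C : R -> R) y| <= C by rewrite /= ger0_norm.
have cfC : continuous (fun y => f y + C).
  by move=> y; apply: cvgD; [exact: cf|exact: cvg_cst].
have fC0 y : 0 <= f y + C.
  by have := fC y; rewrite ler_norml -subr_ge0 opprK => /andP[].
have fCC y : `|f y + C| <= C + C.
  by rewrite (le_trans (ler_normD _ _))// lerD// ger0_norm.
have H1 := poisson_smoothing_ge0 x e0 cfC fC0.
have H2 := poisson_smoothing_ge0 x e0 cC (fun _ => C0).
have I1 := integrable_cauchy_shift e x cfC fCC.
have I2 := integrable_cauchy_shift e x cC CC.
have int_of (g : R -> R) : (forall y, 0 <= g y) -> continuous g ->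
    leb.-integrable setT (fun s => (cauchy_fun s * g (x + e * s))%:E) ->
    leb.-integrable setT (fun y => (g y * poisson e (y - x))%:E).
  move=> g0 cg /integrableP[_ fi]; apply/integrableP; split.
    apply/measurable_EFinP; apply: measurable_funM.
      exact: continuous_measurable_fun.
    apply: (measurableT_comp (measurable_poisson e0)).
    exact: measurable_funB.
  apply: le_lt_trans fi; rewrite le_eqVlt; apply/orP; left; apply/eqP.
  under eq_integral => y _.
    rewrite gee0_abs; last first.
      by rewrite lee_fin mulr_ge0// divr_ge0 ?(ltW e0)// addr_ge0 ?sqr_ge0.
    over.
  rewrite poisson_smoothing_ge0//; apply: eq_integral => s _.
  by rewrite gee0_abs// lee_fin mulr_ge0// cauchy_ge0.
transitivity (\int[leb]_y ((f y + C) * poisson e (y - x)) -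
    \int[leb]_y (cst C y * poisson e (y - x))).
  rewrite -RintegralB//; last 2 first.
  - exact: int_of.
  - exact: int_of.
  by apply: eq_Rintegral => y _ /=; ring.
rewrite /Rintegral H1 H2 -/(Rintegral _ _ _) -/(Rintegral _ _ _) -RintegralB//.
by apply: eq_Rintegral => y _ /=; ring.
Qed.

End poisson.

(** * Uniqueness of the Fourier transform of a finite signed measure *)

(** The image under phi of the measure with density h with respect to mu plays
the role of the signed measure. *)
Section poisson_functional.
Context d (T : measurableType d) (R : realType).
Variable mu : {sigma_finite_measure set T -> \bar R}.
Variables (h phi : T -> R).
Hypothesis ih : mu.-integrable setT (EFin \o h).
Hypothesis mphi : measurable_fun setT phi.
Local Notation leb := (@lebesgue_measure R).

(** The Poisson smoothing of the signed measure depends on it only through its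
cosine and sine transforms. *)
Lemma poisson_transform (e y : R) : 0 < e ->
  \int[mu]_x (h x * poisson e (y - phi x)) =
  \int[leb]_t (half_exp e t * (cos (t * y) * \int[mu]_x (h x * cos (t * phi x))
                         + sin (t * y) * \int[mu]_x (h x * sin (t * phi x)))).
Proof.
move=> e0.
have mtphi : measurable_fun setT (fun z : T * R => (y - phi z.1) * z.2).
  apply: measurable_funM => //; apply: measurable_funB => //.
  exact: measurableT_comp.
have mcos : measurable_fun setT (fun z : T * R => cos ((y - phi z.1) * z.2)).
  exact: (measurableT_comp (continuous_measurable_fun (@continuous_cos R)) mtphi).
transitivity (\int[mu]_x (h x * \int[leb]_t (half_exp e t * cos ((y - phi x) * t)))).
  by apply: eq_Rintegral => x _; rewrite poissonE.
rewrite (@Fubini_weighted _ _ _ (measurableTypeR R) R mu leb h (half_exp e)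
  (fun z => cos ((y - phi z.1) * z.2)) 1 ih (integrable_half_exp e0) mcos)//.
apply: eq_Rintegral => t _; congr (_ * _).
have mphit : measurable_fun setT (fun x => t * phi x) by exact: measurable_funM.
have ic : mu.-integrable setT (fun x => (h x * cos (t * phi x))%:E).
  apply: (integrable_mul_bounded ih _ (C := 1)) => //.
  exact: (measurableT_comp (continuous_measurable_fun (@continuous_cos R))).
have is_ : mu.-integrable setT (fun x => (h x * sin (t * phi x))%:E).
  apply: (integrable_mul_bounded ih _ (C := 1)) => //.
  exact: (measurableT_comp (continuous_measurable_fun (@continuous_sin R))).
rewrite -!RintegralZl// -RintegralD//.
- apply: eq_Rintegral => x _ /=.
  rewrite (_ : (y - phi x) * t = t * y - t * phi x); last by ring.
  by rewrite cosB; ring.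
- exact: (integrableZl measurableT (cos (t * y)) ic).
- exact: (integrableZl measurableT (sin (t * y)) is_).
Qed.

Variables (f : R -> R) (C : R).
Hypothesis cf : continuous f.
Hypothesis fC : forall y, `|f y| <= C.
Hypothesis if_ : leb.-integrable setT (EFin \o f).

Let mf : measurable_fun setT f := continuous_measurable_fun cf.

Let mshift (e : R) : measurable_fun setT (fun z : T * R => f (phi z.1 + e * z.2)).
Proof.
apply: (measurableT_comp mf); apply: measurable_funD => //.
  exact: measurableT_comp.
exact: measurable_funM.
Qed.

(** By symmetry of the kernel, smoothing the signed measure amounts to smoothing
the test function; after the substitution of [poisson_smoothing] the kernel no
longer depends on e, which prepares dominated convergence. *)
Lemma poisson_functional (e : R) : 0 < e ->
  \int[leb]_y (f y * \int[mu]_x (h x * poisson e (y - phi x))) =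
  \int[(mu \x leb)%E]_z (h z.1 * cauchy_fun z.2 * f (phi z.1 + e * z.2)).
Proof.
move=> e0.
have mp : measurable_fun setT (fun z : T * R => poisson e (z.2 - phi z.1)).
  apply: (measurableT_comp (measurable_poisson e0)).
  by apply: measurable_funB => //; exact: measurableT_comp.
rewrite (@Fubini_weighted1 _ _ _ (measurableTypeR R) R mu leb h (@cauchy_fun R)
  (fun z => f (phi z.1 + e * z.2)) C ih (@integrable_cauchy R) (mshift e))//.
rewrite -(@Fubini_weighted _ _ _ (measurableTypeR R) R mu leb h f
  (fun z => poisson e (z.2 - phi z.1)) e^-1 ih if_ mp); last first.
  by move=> z; exact: poisson_bound.
by apply: eq_Rintegral => x _; rewrite /= (poisson_smoothing _ e0 cf fC).
Qed.

Lemma cvg_poisson_functional :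
  \int[(mu \x leb)%E]_z (h z.1 * cauchy_fun z.2 * f (phi z.1 + n.+1%:R^-1 * z.2))
    @[n --> \oo] --> \int[leb]_s (cauchy_fun s) * \int[mu]_x (h x * f (phi x)).
Proof.
have mfphi : measurable_fun setT (fun z : T * R => f (phi z.1)).
  exact: (measurableT_comp (measurableT_comp mf mphi)).
have -> : \int[leb]_s (cauchy_fun s) * \int[mu]_x (h x * f (phi x)) =
    \int[(mu \x leb)%E]_z (h z.1 * cauchy_fun z.2 * f (phi z.1)).
  rewrite (@Fubini_weighted1 _ _ _ (measurableTypeR R) R mu leb h (@cauchy_fun R)
    (fun z => f (phi z.1)) C ih (@integrable_cauchy R) mfphi)//.
  have ihf : mu.-integrable setT (fun x => (h x * f (phi x))%:E).
    apply: (integrable_mul_bounded ih _ (C := C)) => //.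
    exact: measurableT_comp.
  rewrite -RintegralZl//; apply: eq_Rintegral => x _.
  rewrite /= RintegralZr//; last exact: integrable_cauchy.
  by rewrite mulrCA.
have icg (g : T * R -> R) : measurable_fun setT g -> (forall z, `|g z| <= C) ->
    (mu \x leb)%E.-integrable setT (fun z => (h z.1 * cauchy_fun z.2 * g z)%:E).
  exact: (@integrable_product_weighted _ _ _ (measurableTypeR R) R mu leb h
    (@cauchy_fun R) g C ih (@integrable_cauchy R)).
apply: fine_cvg; rewrite -/(Rintegral _ _ _) EFin_Rintegral; last exact: icg.
apply: (@dominated_cvg _ _ _ (mu \x leb)%E _ measurableT
  (fun n z => (h z.1 * cauchy_fun z.2 * f (phi z.1 + n.+1%:R^-1 * z.2))%:E)
  (fun z => (h z.1 * cauchy_fun z.2 * f (phi z.1))%:E)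
  (fun z => `|(h z.1 * cauchy_fun z.2)%:E * C%:E|%E)).
- move=> n; exact: measurable_int (icg _ (mshift _) _).
- move=> z _; apply: cvg_EFin; first exact: nearW.
  apply: cvgM; first exact: cvg_cst.
  apply: continuous_cvg; first exact: cf.
  rewrite -[X in _ --> X]addr0; apply: cvgD; first exact: cvg_cst.
  rewrite -[X in _ --> X](mul0r z.2); apply: cvgM; last exact: cvg_cst.
  exact: cvg_harmonic.
- by [].
- have := @integrable_product_weight _ _ _ (measurableTypeR R) R mu leb h
    (@cauchy_fun R) ih (@integrable_cauchy R).
  by move=> /(integrableZr measurableT C)/integrable_abse.
- move=> n z _; rewrite -EFinM !abse_EFin lee_fin !normrM.
  by rewrite ler_wpM2l ?mulr_ge0// (le_trans (fC _))// ler_norm.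
Qed.

End poisson_functional.

(** Equality holds after smoothing at every scale e > 0, hence in the limit up to
the factor int 1 / (1 + s^2), which is not 0. *)
Lemma fourier_uniqueness (R : realType) d1 (T1 : measurableType d1)
    d2 (T2 : measurableType d2)
    (mu1 : {sigma_finite_measure set T1 -> \bar R})
    (mu2 : {sigma_finite_measure set T2 -> \bar R})
    (h1 phi1 : T1 -> R) (h2 phi2 : T2 -> R) (f : R -> R) (C : R) :
  mu1.-integrable setT (EFin \o h1) -> measurable_fun setT phi1 ->
  mu2.-integrable setT (EFin \o h2) -> measurable_fun setT phi2 ->
  (forall t, \int[mu1]_x (h1 x * cos (t * phi1 x)) =
             \int[mu2]_x (h2 x * cos (t * phi2 x))) ->
  (forall t, \int[mu1]_x (h1 x * sin (t * phi1 x)) =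
             \int[mu2]_x (h2 x * sin (t * phi2 x))) ->
  continuous f -> (forall y, `|f y| <= C) ->
  (@lebesgue_measure R).-integrable setT (EFin \o f) ->
  \int[mu1]_x (h1 x * f (phi1 x)) = \int[mu2]_x (h2 x * f (phi2 x)).
Proof.
move=> ih1 mphi1 ih2 mphi2 eqcos eqsin cf fC if_.
apply: (mulfI (lt0r_neq0 (Rintegral_cauchy_gt0 R))).
have H1 := cvg_poisson_functional ih1 mphi1 cf fC.
have H2 := cvg_poisson_functional ih2 mphi2 cf fC.
rewrite -(cvg_lim _ H1)// -(cvg_lim _ H2)//; congr (lim (_ @ \oo)).
apply/funext => n.
have n0 : 0 < n.+1%:R^-1 :> R by rewrite invr_gt0.
rewrite -(poisson_functional ih1 mphi1 cf fC if_ n0).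
rewrite -(poisson_functional ih2 mphi2 cf fC if_ n0).
apply: eq_Rintegral => y _; congr (_ * _).
rewrite !poisson_transform//.
by apply: eq_Rintegral => t _; rewrite eqcos eqsin.
Qed.

(** * Exponents of gamma laws *)

Section signed_half_exp.
Context (R : realType).
Local Notation leb := (@lebesgue_measure R).
Implicit Types (b z u : R).

(** For a negative rate the exponential lives on u < 0 and carries a minus sign,
as does u times a Levy density there. With this convention the transforms are
given by the same formulas for both signs. *)
Definition signed_half_exp b u : R :=
  if 0 < b then half_exp b u else - half_exp (- b) (- u).

Lemma integrable_signed_half_exp b : b != 0 ->
  leb.-integrable setT (EFin \o signed_half_exp b).
Proof.
move=> b0; rewrite /signed_half_exp.
case: ltP => [|b_le0]; first exact: integrable_half_exp.
have nb0 : 0 < - b by rewrite oppr_gt0 lt_neqAle b0.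
have := integrableN (integrable_reflection (integrable_half_exp nb0)).
by [].
Qed.

Lemma signed_half_exp_cos b z : b != 0 ->
  \int[leb]_u (signed_half_exp b u * cos (z * u)) = b / (b ^+ 2 + z ^+ 2).
Proof.
move=> b0; rewrite /signed_half_exp; case: ltP => [|b_le0]; first exact: laplace_cos.
have nb0 : 0 < - b by rewrite oppr_gt0 lt_neqAle b0.
have ic : leb.-integrable setT (fun u => (half_exp (- b) u * cos (z * u))%:E).
  exact: (integrable_mul_bounded (integrable_half_exp nb0)
    (measurable_cosM z) (fun u => cos_max _)).
have := laplace_cos z nb0; rewrite -Rintegral_reflection// => H.
have -> : b / (b ^+ 2 + z ^+ 2) = -1 * (- b / ((- b) ^+ 2 + z ^+ 2)).
  by rewrite sqrrN; ring.
rewrite -H -RintegralZl//.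
  by apply: eq_Rintegral => u _; rewrite mulrN cosN; ring.
exact: integrable_reflection ic.
Qed.

Lemma signed_half_exp_sin b z : b != 0 ->
  \int[leb]_u (signed_half_exp b u * sin (z * u)) = z / (b ^+ 2 + z ^+ 2).
Proof.
move=> b0; rewrite /signed_half_exp; case: ltP => [|b_le0]; first exact: laplace_sin.
have nb0 : 0 < - b by rewrite oppr_gt0 lt_neqAle b0.
have ic : leb.-integrable setT (fun u => (half_exp (- b) u * sin (z * u))%:E).
  exact: (integrable_mul_bounded (integrable_half_exp nb0)
    (measurable_sinM z) (fun u => sin_max _)).
have := laplace_sin z nb0; rewrite -Rintegral_reflection// sqrrN => <-.
by apply: eq_Rintegral => u _; rewrite mulrN sinN; ring.
Qed.

End signed_half_exp.

Section gamma_exponent.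
Context (R : realType).
Implicit Types (b s z : R).

(** Real and imaginary parts of - s log(1 - iz/b), the exponent of c X when X has
law Ga(a, s) and b = a / c. *)
Definition log_modulus s b z : R := - s * ln (Num.sqrt (1 + (z / b) ^+ 2)).
Definition phase s b z : R := s * atan (z / b).

Let ge1 b z : 1 <= 1 + (z / b) ^+ 2.
Proof. by rewrite lerDl sqr_ge0. Qed.

Let gt0 b z : 0 < 1 + (z / b) ^+ 2.
Proof. exact: lt_le_trans (ge1 b z). Qed.

Let denom b z : b != 0 -> b ^+ 2 + z ^+ 2 != 0.
Proof. by move=> b0; rewrite gt_eqF// ltr_wpDr ?sqr_ge0// exprn_even_gt0. Qed.

Lemma log_modulusE s b z : log_modulus s b z = - (s / 2) * ln (1 + (z / b) ^+ 2).
Proof.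
rewrite /log_modulus -[in RHS](sqr_sqrtr (ltW (gt0 b z))) lnXn ?sqrtr_gt0//.
by rewrite -mulr_natl; field.
Qed.

Lemma is_derive_log_modulus s b z : b != 0 ->
  is_derive z 1 (log_modulus s b) (- s * (z / (b ^+ 2 + z ^+ 2))).
Proof.
move=> b0.
have -> : log_modulus s b = (fun z => - (s / 2) * ln (1 + (z / b) ^+ 2)).
  by apply/funext => y; exact: log_modulusE.
have dl := is_derive1_ln (gt0 b z).
have dq : is_derive z 1 (fun z => 1 + (z / b) ^+ 2) (2 * (z / b) / b).
  by apply: is_derive_eq; rewrite /GRing.scale/=; field.
have dc := @is_derive1_comp _ (@ln R) (fun z => 1 + (z / b) ^+ 2) z _ _ dl dq.
have dm := is_deriveZ (- (s / 2)) dc.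
apply: is_derive_eq; rewrite /GRing.scale/=; field.
by rewrite b0 denom.
Qed.

Lemma is_derive_phase s b z : b != 0 ->
  is_derive z 1 (phase s b) (s * (b / (b ^+ 2 + z ^+ 2))).
Proof.
move=> b0; rewrite /phase; apply: is_derive_eq; rewrite /GRing.scale/=.
have g0 := gt0 b z; field.
by rewrite b0 denom.
Qed.

Lemma log_modulus0 s b : log_modulus s b 0 = 0.
Proof. by rewrite log_modulusE mul0r expr0n addr0 ln1 mulr0. Qed.

Lemma phase0 s b : phase s b 0 = 0.
Proof. by rewrite /phase mul0r atan0 mulr0. Qed.

Lemma log_modulus_le0 s b z : 0 <= s -> log_modulus s b z <= 0.
Proof.
move=> s0; rewrite log_modulusE mulNr oppr_le0 mulr_ge0 ?divr_ge0//.
by rewrite ln_ge0.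
Qed.

Lemma log_modulus_ge s b z : 0 <= s ->
  - (s / 2 / b ^+ 2) * z ^+ 2 <= log_modulus s b z.
Proof.
move=> s0; rewrite log_modulusE !mulNr lerN2 -[leRHS]mulrA ler_wpM2l ?divr_ge0//.
rewrite [leRHS]mulrC -expr_div_n; apply: le_ln1Dx.
exact: lt_le_trans (sqr_ge0 _).
Qed.

End gamma_exponent.

(** * Differentiation under the integral sign, and first moments *)

Section under_integral.
Context d (T : measurableType d) (R : realType) (mu : {measure set T -> \bar R}).

Lemma is_derive_Rintegral (F dF : R -> T -> R) (G : T -> R) (z : R) :
  (forall t, mu.-integrable setT (EFin \o F t)) ->
  (forall (t : R) x, is_derive t 1 (F ^~ x) (dF t x)) ->
  mu.-integrable setT (EFin \o G) -> (forall t x, `|dF t x| <= G x) ->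
  is_derive z 1 (fun t => \int[mu]_x F t x) (\int[mu]_x dF z x).
Proof.
move=> iF dFE iG FG.
have zI : z \in `]z - 1, z + 1[ by rewrite in_itv/=; apply/andP; split; lra.
have pE t x : partial1of2 F t x = dF t x.
  by rewrite partial1of2E; have := dFE t x => ?; exact: derive_val.
have G0 x : 0 <= G x := le_trans (normr_ge0 _) (FG z x).
have dF' t x : `]z - 1, z + 1[%classic t -> [set: T] x -> derivable (F ^~ x) t 1.
  by move=> _ _; case: (dFE t x).
have FG' t x : `]z - 1, z + 1[%classic t -> [set: T] x -> `|partial1of2 F t x| <= G x.
  by move=> _ _; rewrite pE.
have iF' t : `]z - 1, z + 1[%classic t -> mu.-integrable setT (EFin \o F t) by [].
apply: DeriveDef.
  exact: (@derivable_under_integral R _ T mu F setT measurableT z _ _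
    zI iF' dF' G G0 iG FG').
rewrite -derive1E.
rewrite (@differentiation_under_integral R _ T mu F setT measurableT z _ _
  zI iF' dF' G G0 iG FG').
by apply: eq_Rintegral => x _; rewrite pE.
Qed.

End under_integral.

Section sine_bounds.
Context (R : realType).
Implicit Types x : R.

Lemma norm_increment_le (f f' : R -> R) (M x y : R) :
  (forall t : R, is_derive t 1 f (f' t)) -> (forall t, `|f' t| <= M) ->
  `|f y - f x| <= M * `|y - x|.
Proof.
move=> df fM.
have cf : continuous f.
  by move=> u; apply/differentiable_continuous/derivable1_diffP; case: (df u).
wlog xy : x y / x <= y => [H|].
  by case/orP: (le_total x y) => /H// ; rewrite distrC (distrC x).
have [|c _ ->] := @MVT_segment _ f f' x y xy (fun t _ => df t).
  exact: continuous_subspaceT.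
by rewrite normrM ler_wpM2r.
Qed.

Lemma norm_sin_le x : `|sin x| <= `|x|.
Proof.
have := @norm_increment_le sin cos 1 0 x (@is_derive_sin R) (@cos_max R).
by rewrite sin0 !subr0 mul1r.
Qed.

Lemma one_sub_cosE x : 1 - cos (2 * x) = 2 * sin x ^+ 2.
Proof. by rewrite mulrC mulr_natr cos_mulr2n cos2sin2; ring. Qed.

Lemma one_sub_cos_le x : 1 - cos x <= x ^+ 2 / 2.
Proof.
have -> : x = 2 * (x / 2) by field.
rewrite one_sub_cosE exprMn.
rewrite -(real_normK (num_real (sin _))) -(real_normK (num_real (x / 2))).
have : `|sin (x / 2)| ^+ 2 <= `|x / 2| ^+ 2.
  by rewrite ler_pXn2r// ?nnegrE// norm_sin_le.
by move=> ?; lra.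
Qed.

(** This is the derivative of h |-> sin(h x) at 0, along h = 1/(n+1). *)
Lemma cvg_sin_quotient x :
  (n.+1%:R * sin (n.+1%:R^-1 * x)) ^+ 2 @[n --> \oo] --> x ^+ 2.
Proof.
apply: (cvg_comp (fun n : nat => n.+1%:R * sin (n.+1%:R^-1 * x)) (fun y => y ^+ 2));
  last exact: exprn_continuous.
have ds : is_derive (0 : R) 1 (fun h => sin (h * x)) x.
  by apply: is_derive_eq; rewrite /GRing.scale/= mul0r cos0; ring.
have [/cvg_ex[/= l sl] dv] := ds.
have lx : l = x.
  by rewrite -dv; apply/esym/cvg_lim => //.
move: sl; rewrite lx => /cvgr_dnbhsP/(_ (fun n : nat => n.+1%:R^-1)) H.
have /H : (forall n : nat, n.+1%:R^-1 != 0 :> R) /\ (n.+1%:R^-1 : R) @[n --> \oo] --> 0.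
  by split; [move=> n; rewrite invr_eq0 pnatr_eq0|exact: cvg_harmonic].
by under eq_cvg do rewrite scaler1 addr0 mul0r sin0 subr0 /GRing.scale/= invrK.
Qed.

End sine_bounds.

Section second_moment.
Local Open Scope ereal_scope.
Context d (T : measurableType d) (R : realType) (P : probability T R).

(** Fatou's lemma for (n sin(X/n))^2, which tends to X^2 and whose expectation is
n^2 (1 - Re phi(2/n)) / 2 by the half-angle formula, bounds the second moment by
2 C. *)
Lemma integrable_of_charfun_bound (X : T -> R) (C : R) :
  measurable_fun setT X ->
  (forall z, 1 - Rintegral P setT (fun x => cos (z * X x)) <= C * z ^+ 2)%R ->
  P.-integrable setT (EFin \o X).
Proof.
move=> mX XC.
have i0 : P.-integrable setT (EFin \o cst (1%R : R)).
  exact: finite_measure_integrable_cst.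
have icos z : P.-integrable setT (EFin \o (fun x => cos (z * X x))%R).
  apply: (@integrable_le _ _ _ _ _ (cst 1%R)).
  - apply: (measurableT_comp (continuous_measurable_fun (@continuous_cos R))).
    exact: measurable_funM.
  - by move=> x; exact: cos_max.
  - exact: i0.
pose f (n : nat) x := ((n.+1%:R * sin (n.+1%:R^-1 * X x)) ^+ 2)%R.
have mf n : measurable_fun setT (f n).
  apply: measurable_funX; apply: measurable_funM => //.
  apply: (measurableT_comp (continuous_measurable_fun (@continuous_sin R))).
  exact: measurable_funM.
have fE n : \int[P]_x (f n x)%:E <= (2 * C)%:E.
  have -> : \int[P]_x (f n x)%:E = ((n.+1%:R ^+ 2 / 2) *
      (1 - Rintegral P setT (fun x => cos (2 * n.+1%:R^-1 * X x))))%:E.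
    have -> : (1 - Rintegral P setT (fun x => cos (2 * n.+1%:R^-1 * X x)) =
        Rintegral P setT (fun x => cst 1 x - cos (2 * n.+1%:R^-1 * X x)))%R.
      by rewrite RintegralB// Rintegral_cst//= probability_setT mulr1.
    have i1 : P.-integrable setT
        (EFin \o (fun x => cst 1 x - cos (2 * n.+1%:R^-1 * X x))%R).
      exact: (integrableB measurableT i0 (icos _)).
    rewrite -RintegralZl// EFin_Rintegral; last exact: (integrableZl measurableT _ i1).
    apply: eq_integral => x _; congr EFin.
    by rewrite /f /= -mulrA one_sub_cosE; field.
  rewrite lee_fin.
  apply: (@le_trans _ _ (n.+1%:R ^+ 2 / 2 * (C * (2 * n.+1%:R^-1) ^+ 2))%R).
    by rewrite ler_wpM2l// divr_ge0// exprn_ge0.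
  rewrite le_eqVlt; apply/orP; left; apply/eqP; field.
  by rewrite addrC natr1 pnatr_eq0.
have fX x : limn_einf (fun n => (f n x)%:E) = (X x ^+ 2)%:E.
  have H : (f n x)%:E @[n --> \oo] --> (X x ^+ 2)%:E.
    by apply: cvg_EFin; [exact: nearW|exact: cvg_sin_quotient].
  by rewrite is_cvg_limn_einfE; [exact: cvg_lim|apply/cvg_ex; exists (X x ^+ 2)%:E].
have X2 : \int[P]_x (X x ^+ 2)%:E <= (2 * C)%:E.
  rewrite (eq_integral (fun x => limn_einf (fun n => (f n x)%:E))); last first.
    by move=> x _; rewrite fX.
  apply: (le_trans (fatou _ _ _ _)) => //.
  - by move=> n; exact/measurable_EFinP.
  - by move=> n x _; rewrite lee_fin sqr_ge0.
  rewrite limn_einf_lim; apply: lime_le; first exact: is_cvg_einfs.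
  apply: nearW => n; apply: le_trans (fE n).
  by apply: ereal_inf_lbound; exists n => /=.
apply: (@integrable_le _ _ _ _ _ (fun x => 1 + X x ^+ 2)%R) => //.
  move=> x; have := sqr_ge0 (`|X x| - 2^-1)%R; rewrite sqrrB real_normK ?num_real//.
  by move=> ?; lra.
apply/integrableP; split.
  by apply/measurable_EFinP; apply: measurable_funD => //; exact: measurable_funX.
under eq_integral => x _ do rewrite /= ger0_norm ?addr_ge0 ?sqr_ge0// EFinD.
rewrite ge0_integralD//=.
- rewrite lte_add_pinfty ?(le_lt_trans X2) ?ltry//.
  by rewrite integral_cst//= probability_setT mul1e ltry.
- by move=> x _; rewrite lee_fin sqr_ge0.
- by apply/measurable_EFinP; exact: measurable_funX.
Qed.

End second_moment.

(** * The Stein identity from the exponent of the characteristic function *)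

Section probability_product.
Context d1 d2 (T1 : measurableType d1) (T2 : measurableType d2) (R : realType).
Variables (P : probability T1 R) (m : {sigma_finite_measure set T2 -> \bar R}).

(** A separate name for the product, which carries the sigma-finite structure that
[fourier_uniqueness] asks for. *)
Definition probability_product : set (T1 * T2) -> \bar R := (P \x m)%E.

HB.instance Definition _ := Measure.on probability_product.

Let probability_product_sigma_finite : sigma_finite setT probability_product.
Proof.
have /sigma_finiteP[F [TF _ Foo]] := sigma_finiteT m.
exists (fun n => setT `*` F n); first by rewrite -setX_bigcupr -TF setXTT.
move=> n; have [mF Fn] := Foo n; split; first exact: measurableX.
rewrite /probability_product product_measure1E//.
by rewrite [X in (X * _)%E](_ : _ = 1%E) ?mul1e//; exact: probability_setT.
Qed.

HB.instance Definition _ := Measure_isSigmaFinite.Build _ _ _ probability_product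
  probability_product_sigma_finite.

End probability_product.

Section stein_identity.
Context d (Omega : measurableType d) (R : realType) (P : probability Omega R).
Local Notation leb := (@lebesgue_measure R).
Variables (X : Omega -> R) (k A B : R -> R) (C : R).
Hypothesis mX : measurable_fun setT X.
Hypothesis ik : leb.-integrable setT (EFin \o k).
Hypothesis dA : forall z : R, is_derive z 1 A (- \int[leb]_u (k u * sin (z * u))).
Hypothesis dB : forall z : R, is_derive z 1 B (\int[leb]_u (k u * cos (z * u))).
Hypothesis A_le0 : forall z, A z <= 0.
Hypothesis A_ge : forall z, - (C * z ^+ 2) <= A z.
Hypothesis B0 : B 0 = 0.
Hypothesis EcosX : forall z, \int[P]_w cos (z * X w) = expR (A z) * cos (B z).
Hypothesis EsinX : forall z, \int[P]_w sin (z * X w) = expR (A z) * sin (B z).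

Let mcosX z : measurable_fun setT (fun w => cos (z * X w)).
Proof. exact: (measurableT_comp (measurable_cosM z)). Qed.

Let msinX z : measurable_fun setT (fun w => sin (z * X w)).
Proof. exact: (measurableT_comp (measurable_sinM z)). Qed.

Let i1 : P.-integrable setT (EFin \o cst (1 : R)).
Proof. exact: finite_measure_integrable_cst. Qed.

Let icosX z : P.-integrable setT (EFin \o (fun w => cos (z * X w))).
Proof. by apply: (integrable_le (mcosX z) _ i1) => w; exact: cos_max. Qed.

Let isinX z : P.-integrable setT (EFin \o (fun w => sin (z * X w))).
Proof. by apply: (integrable_le (msinX z) _ i1) => w; exact: sin_max. Qed.

Let ikcos z : leb.-integrable setT (fun u => (k u * cos (z * u))%:E).
Proof.
by apply: (integrable_mul_bounded ik (measurable_cosM z) (C := 1)) => u; exact: cos_max.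
Qed.

Let iksin z : leb.-integrable setT (fun u => (k u * sin (z * u))%:E).
Proof.
by apply: (integrable_mul_bounded ik (measurable_sinM z) (C := 1)) => u; exact: sin_max.
Qed.

Lemma norm_phase_le z : `|B z| <= \int[leb]_u `|k u| * `|z|.
Proof.
have := @norm_increment_le _ B _ (\int[leb]_u `|k u|) 0 z dB.
rewrite B0 !subr0; apply => t.
apply: le_trans (le_normr_Rintegral _ (ikcos t)) _ => //.
apply: le_Rintegral => //.
- exact: integrable_norm (ikcos t).
- exact: integrable_norm ik.
- by move=> u _; rewrite normrM ler_piMr// cos_max.
Qed.

(** Since e^A and cos B are at most 1, 1 - e^A cos B is at most
(1 - e^A) + (1 - cos B), and each summand is O(z^2). *)
Lemma integrable_of_exponent : P.-integrable setT (EFin \o X).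
Proof.
pose K := \int[leb]_u `|k u|.
apply: (@integrable_of_charfun_bound _ _ _ _ _ (C + K ^+ 2 / 2) mX) => z.
rewrite EcosX.
have e1 : 1 + A z <= expR (A z) by exact: expR_ge1Dx.
have e2 : expR (A z) <= 1 by rewrite -expR0 ler_expR.
have c1 := one_sub_cos_le (B z).
have c2 := cos_le1 (B z).
have c3 : 0 <= (1 - expR (A z)) * (1 - cos (B z)) by rewrite mulr_ge0 ?subr_ge0.
have b2 : B z ^+ 2 <= K ^+ 2 * z ^+ 2.
  rewrite -exprMn -(real_normK (num_real (B z))) -(real_normK (num_real (K * z))).
  rewrite ler_pXn2r ?nnegrE// normrM (@ger0_norm _ K) ?norm_phase_le//.
  by apply: Rintegral_ge0.
have := A_ge z; lra.
Qed.

(** The derivative of E cos(zX), computed under the expectation and from the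
polar form. *)
Lemma EXsinX z : \int[P]_w (X w * sin (z * X w)) =
  \int[leb]_u (k u * sin (z * u)) * (expR (A z) * cos (B z)) +
  \int[leb]_u (k u * cos (z * u)) * (expR (A z) * sin (B z)).
Proof.
have d1 : is_derive z 1 (fun z => \int[P]_w cos (z * X w))
    (\int[P]_w (- (X w * sin (z * X w)))).
  apply: (@is_derive_Rintegral _ _ _ _ (fun z w => cos (z * X w))
    (fun z w => - (X w * sin (z * X w))) (fun w => `|X w|) z icosX).
  - by move=> t w; apply: is_derive_eq; rewrite /GRing.scale/=; ring.
  - exact: integrable_norm integrable_of_exponent.
  - by move=> t w; rewrite normrN normrM ler_piMr// sin_max.
have d2 : is_derive z 1 (fun z => expR (A z) * cos (B z))
    (expR (A z) * (- sin (B z) * \int[leb]_u (k u * cos (z * u)))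
     + cos (B z) * (expR (A z) * - \int[leb]_u (k u * sin (z * u)))).
  have ? := dA z; have ? := dB z; exact: is_derive_eq.
have := d1; rewrite (_ : (fun _ => _) = (fun z => expR (A z) * cos (B z))); last first.
  by apply/funext => t; exact: EcosX.
move=> d1'; have := @derive_val _ _ _ _ _ _ _ d1'.
rewrite (@derive_val _ _ _ _ _ _ _ d2).
under [X in _ = X -> _]eq_Rintegral do rewrite -mulN1r.
rewrite RintegralZl//; first by move=> H; lra.
exact: (integrable_mul_bounded integrable_of_exponent (msinX z)
  (fun w => sin_max _)).
Qed.

Lemma EXcosX z : \int[P]_w (X w * cos (z * X w)) =
  \int[leb]_u (k u * cos (z * u)) * (expR (A z) * cos (B z)) -
  \int[leb]_u (k u * sin (z * u)) * (expR (A z) * sin (B z)).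
Proof.
have d1 : is_derive z 1 (fun z => \int[P]_w sin (z * X w))
    (\int[P]_w (X w * cos (z * X w))).
  apply: (@is_derive_Rintegral _ _ _ _ (fun z w => sin (z * X w))
    (fun z w => X w * cos (z * X w)) (fun w => `|X w|) z isinX).
  - by move=> t w; apply: is_derive_eq; rewrite /GRing.scale/=; ring.
  - exact: integrable_norm integrable_of_exponent.
  - by move=> t w; rewrite normrM ler_piMr// cos_max.
have d2 : is_derive z 1 (fun z => expR (A z) * sin (B z))
    (expR (A z) * (cos (B z) * \int[leb]_u (k u * cos (z * u)))
     + sin (B z) * (expR (A z) * - \int[leb]_u (k u * sin (z * u)))).
  have ? := dA z; have ? := dB z; exact: is_derive_eq.
have := d1; rewrite (_ : (fun _ => _) = (fun z => expR (A z) * sin (B z))); last first.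
  by apply/funext => t; exact: EsinX.
move=> d1'; have := @derive_val _ _ _ _ _ _ _ d1'.
rewrite (@derive_val _ _ _ _ _ _ _ d2) => <-.
by ring.
Qed.

Section product.
Variables (g : R -> R) (D : R).
Hypothesis mg : measurable_fun setT g.
Hypothesis gD : forall x, `|g x| <= D.

Let mgX : measurable_fun setT (fun z : Omega * R => g (X z.1 + z.2)).
Proof.
apply: (measurableT_comp mg); apply: measurable_funD => //.
exact: measurableT_comp.
Qed.

Lemma Rintegral_translate :
  \int[(P \x leb)%E]_z (cst 1 z.1 * k z.2 * g (X z.1 + z.2)) =
  \int[P]_w \int[leb]_u (k u * g (X w + u)).
Proof.
rewrite (@Fubini_weighted1 _ _ _ (measurableTypeR R) R P leb (cst 1) k
  (fun z => g (X z.1 + z.2)) D i1 ik mgX)//.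
by apply: eq_Rintegral => w _; rewrite /= mul1r.
Qed.

Lemma integrable_translate :
  P.-integrable setT (fun w => (\int[leb]_u (k u * g (X w + u)))%:E).
Proof.
have := @integrable_Fubini_weighted1 _ _ _ (measurableTypeR R) R P leb (cst 1) k
  (fun z => g (X z.1 + z.2)) D i1 ik mgX (fun z => gD _).
by congr (_.-integrable _ _); apply/funext => w; rewrite /= mul1r.
Qed.

End product.

(** The addition formulas split cos(t(X+u)) and sin(t(X+u)), so that the transform
of the convolution of the law of X with k(u)du is the product of the transforms;
by [EXcosX] and [EXsinX] this is the transform of x mu(dx). *)
Theorem stein_identity (f : R -> R) (D : R) : continuous f ->
  (forall y, `|f y| <= D) -> leb.-integrable setT (EFin \o f) ->
  \int[P]_w (X w * f (X w)) = \int[P]_w \int[leb]_u (k u * f (X w + u)).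
Proof.
move=> cf fD if_.
have mf := continuous_measurable_fun cf.
rewrite -(Rintegral_translate mf fD).
have mphi : measurable_fun setT (fun z : Omega * R => X z.1 + z.2).
  by apply: measurable_funD => //; exact: measurableT_comp.
have H := @fourier_uniqueness R _ Omega _ _ P (probability_product P leb)
  X X (fun z => cst 1 z.1 * k z.2) (fun z => X z.1 + z.2) f D.
apply: H => //.
- exact: integrable_of_exponent.
- exact: (@integrable_product_weight _ _ _ (measurableTypeR R) R P leb (cst 1) k i1 ik).
- move=> t; rewrite (@Rintegral_translate (fun x => cos (t * x)) 1); last 2 first.
  + exact: measurable_cosM.
  + by move=> x; exact: cos_max.
  rewrite EXcosX -EcosX -EsinX -!RintegralZl// -RintegralB//; last 2 first.
  + exact: (integrableZl measurableT _ (icosX t)).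
  + exact: (integrableZl measurableT _ (isinX t)).
  apply: eq_Rintegral => w _; rewrite -RintegralZr; [|by []|exact: ikcos].
  rewrite -RintegralZr; [|by []|exact: iksin].
  rewrite -RintegralB; [|by []|exact: (integrableZr measurableT _ (ikcos t))
    |exact: (integrableZr measurableT _ (iksin t))].
  by apply: eq_Rintegral => u _; rewrite mulrDr cosD; ring.
- move=> t; rewrite (@Rintegral_translate (fun x => sin (t * x)) 1); last 2 first.
  + exact: measurable_sinM.
  + by move=> x; exact: sin_max.
  rewrite EXsinX -EcosX -EsinX -!RintegralZl// -RintegralD//; last 2 first.
  + exact: (integrableZl measurableT _ (icosX t)).
  + exact: (integrableZl measurableT _ (isinX t)).
  apply: eq_Rintegral => w _; rewrite -RintegralZr; [|by []|exact: iksin].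
  rewrite -RintegralZr; [|by []|exact: ikcos].
  rewrite -RintegralD; [|by []|exact: (integrableZr measurableT _ (iksin t))
    |exact: (integrableZr measurableT _ (ikcos t))].
  by apply: eq_Rintegral => u _; rewrite mulrDr sinD; ring.
Qed.

End stein_identity.

(** * Sums of independent random variables *)

Section decoupling.
Context d (Omega : measurableType d) (R : realType) (P : probability Omega R).
Variable Z : Omega -> R.
Hypothesis mZ : measurable_fun setT Z.

Let ibounded (W : Omega -> R) (M : R) : measurable_fun setT W ->
  (forall w, `|W w| <= M) -> P.-integrable setT (EFin \o W).
Proof.
move=> mW WM; apply: (integrable_le mW WM).
exact: finite_measure_integrable_cst.
Qed.

Lemma Rintegral_indic_preimage (A : set (measurableTypeR R)) : measurable A ->
  \int[P]_w \1_A (Z w) = fine (P (Z @^-1` A)).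
Proof.
move=> mA.
have mZA : measurable (Z @^-1` A) by rewrite -[X in measurable X]setTI; exact: mZ.
have := integral_indic P measurableT mZA; rewrite setIT => <-.
by rewrite /Rintegral; congr fine.
Qed.

Let decouple_ge0 (W : Omega -> R) (M : R) (g : R -> R) (N : R) :
  measurable_fun setT W -> (forall w, 0 <= W w) -> (forall w, `|W w| <= M) ->
  measurable_fun setT g -> (forall x, 0 <= g x) -> (forall x, `|g x| <= N) ->
  (forall A : set (measurableTypeR R), measurable A ->
    \int[P]_w (W w * \1_A (Z w)) = \int[P]_w W w * fine (P (Z @^-1` A))) ->
  \int[P]_w (W w * g (Z w)) = \int[P]_w W w * \int[P]_w g (Z w).
Proof.
move=> mW W0 WM mg g0 gN WA.
have iW := ibounded mW WM.
have W0' : 0 <= \int[P]_w W w by apply: Rintegral_ge0.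
have [nu [nuE nuint]] := density_measure_exists P W0 mW.
have mgZ : measurable_fun setT (fun w => g (Z w)) by exact: measurableT_comp.
have mgE : measurable_fun setT (EFin \o g) by exact/measurable_EFinP.
pose k := NngNum W0'.
suff H : (\int[P]_w (g (Z w) * W w)%:E = (\int[P]_w W w)%:E * \int[P]_w (g (Z w))%:E)%E.
  transitivity (\int[P]_w (g (Z w) * W w)).
    by apply: eq_Rintegral => w _; rewrite mulrC.
  have := integrable_fin_num measurableT (ibounded mgZ (fun w => gN (Z w))).
  by rewrite [LHS]/Rintegral H => fg; rewrite fineM.
rewrite -nuint//.
have gE0 : {in setT, forall y : R, (0 <= (EFin \o g) y)%E}.
  by move=> y _; rewrite /= lee_fin.
have pushE (m : {measure set Omega -> \bar R}) :=
  @ge0_integral_pushforward _ _ Omega (measurableTypeR R) R _ mZ m setT _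
    measurableT mgE gE0.
refine (etrans (esym (pushE nu)) _).
refine (etrans _ (congr1 (mule _) (pushE P))).
rewrite -(@ge0_integral_mscale _ _ _ _ _ measurableT k); last 2 first.
- exact: mgE.
- by move=> y _; rewrite lee_fin.
apply: eq_measure_integral => A mA _.
have mZA : measurable (Z @^-1` A) by rewrite -[X in measurable X]setTI; exact: mZ.
transitivity ((\int[P]_w W w * fine (P (Z @^-1` A)))%:E); last first.
  by rewrite EFinM (@fineK _ (P (Z @^-1` A))) ?fin_num_measure.
rewrite [LHS](nuE _ mZA) -WA//.
have mA1 : measurable_fun setT (fun w => \1_A (Z w) : R).
  by apply: (measurableT_comp _ mZ); exact: measurable_indic.
rewrite EFin_Rintegral; last first.
  apply: (integrable_mul_bounded iW mA1 (C := 1)) => w.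
  by rewrite ger0_norm.
rewrite [LHS]integral_mkcond; apply: eq_integral => w _.
by rewrite epatch_indic EFinM.
Qed.

(** For nonnegative W and g, the hypothesis says that the image under Z of the
measure with density W is a multiple of the law of Z; integrate g against both.
Constants are added to W and g to reach this case. *)
Lemma decouple (W : Omega -> R) (M : R) (g : R -> R) (N : R) :
  measurable_fun setT W -> (forall w, `|W w| <= M) ->
  measurable_fun setT g -> (forall x, `|g x| <= N) ->
  (forall A : set (measurableTypeR R), measurable A ->
    \int[P]_w (W w * \1_A (Z w)) = \int[P]_w W w * fine (P (Z @^-1` A))) ->
  \int[P]_w (W w * g (Z w)) = \int[P]_w W w * \int[P]_w g (Z w).
Proof.
move=> mW WM mg gN WA.
have iW := ibounded mW WM.
have mgZ : measurable_fun setT (fun w => g (Z w)) by exact: measurableT_comp.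
have ig := ibounded mgZ (fun w => gN (Z w)).
have ic (c : R) : P.-integrable setT (EFin \o cst c).
  exact: finite_measure_integrable_cst.
have iWg : P.-integrable setT (EFin \o (fun w => W w * g (Z w))).
  by apply: (integrable_mul_bounded iW mgZ (C := N)).
have cE (c : R) : \int[P]_w c = c.
  by rewrite (Rintegral_cst P measurableT c)/= probability_setT mulr1.
have shift_ge0 (a b : R) : `|a| <= b -> 0 <= a + b.
  by rewrite ler_norml -subr_ge0 opprK => /andP[].
have shift_le (a b : R) : `|a| <= b -> `|a + b| <= b + b.
  move=> ab; rewrite (le_trans (ler_normD _ _))// lerD//.
  by rewrite ger0_norm// (le_trans _ ab).
have := @decouple_ge0 (fun w => W w + M) (M + M) (fun x => g x + N) (N + N).
have E1 : \int[P]_w (W w + M) = \int[P]_w W w + M.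
  by rewrite (RintegralD _ iW (ic M))// cE.
have E2 : \int[P]_w (g (Z w) + N) = \int[P]_w g (Z w) + N.
  by rewrite (RintegralD _ ig (ic N))// cE.
have E3 : \int[P]_w ((W w + M) * (g (Z w) + N)) =
  \int[P]_w (W w * g (Z w)) + N * \int[P]_w W w + M * \int[P]_w g (Z w) + M * N.
  have i1 := integrableZl measurableT N iW.
  have i2 := integrableZl measurableT M ig.
  have i3 := integrableD measurableT iWg i1.
  have i4 := integrableD measurableT i3 i2.
  transitivity (\int[P]_w ((W w * g (Z w) + N * W w + M * g (Z w)) + M * N)).
    by apply: eq_Rintegral => w _; ring.
  rewrite (RintegralD _ i4 (ic (M * N)))// cE (RintegralD _ i3 i2)//.
  rewrite (RintegralD _ iWg i1)//.
  by rewrite !RintegralZl.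
rewrite E1 E2 E3 => H.
suff : \int[P]_w (W w * g (Z w)) + N * \int[P]_w W w + M * \int[P]_w g (Z w) + M * N =
    (\int[P]_w W w + M) * (\int[P]_w g (Z w) + N) by move=> ?; lra.
apply: H.
- exact: measurable_funD.
- by move=> w; exact: shift_ge0.
- by move=> w; exact: shift_le.
- exact: measurable_funD.
- by move=> x; exact: shift_ge0.
- by move=> x; exact: shift_le.
- move=> A mA; rewrite mulrDl -WA//.
  have mZA : measurable (Z @^-1` A) by rewrite -[X in measurable X]setTI; exact: mZ.
  have mA1 : measurable_fun setT (fun w => \1_A (Z w) : R).
    by apply: (measurableT_comp _ mZ); exact: measurable_indic.
  have iA : P.-integrable setT (EFin \o (fun w => \1_A (Z w) : R)).
    by apply: (ibounded mA1 (M := 1)) => w; rewrite ger0_norm.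
  have iWA : P.-integrable setT (EFin \o (fun w => W w * \1_A (Z w))).
    by apply: (integrable_mul_bounded iW mA1 (C := 1)) => w; rewrite ger0_norm.
  transitivity (\int[P]_w (W w * \1_A (Z w) + M * \1_A (Z w))).
    by apply: eq_Rintegral => w _; rewrite mulrDl.
  rewrite (RintegralD _ iWA (integrableZl measurableT M iA))// RintegralZl//.
  by rewrite Rintegral_indic_preimage.
Qed.

End decoupling.

(** Independence is only given for events. The induction behind
[Ecos_sum_Esin_sum] starts from the expectation of a product of indicators of
events and replaces them one index at a time by phases: s lists the indices
already replaced, and the indicators of the others are kept in the integrand so
that [decouple] applies to the next index. *)
Section independent_sum.
Context d (Omega : measurableType d) (R : realType) (P : probability Omega R).
Variables (I : finType) (Z : I -> Omega -> R) (c a b : I -> R).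
Hypothesis mZ : forall i, measurable_fun setT (Z i).
Hypothesis indep : mutually_independent P Z.
Hypothesis EcosZ : forall i, \int[P]_w cos (c i * Z i w) = expR (a i) * cos (b i).
Hypothesis EsinZ : forall i, \int[P]_w sin (c i * Z i w) = expR (a i) * sin (b i).

Implicit Types (s : seq I) (A : I -> set (measurableTypeR R)).

Let angle s w := \sum_(i <- s) c i * Z i w.
Let events s A w : R := \prod_(i | i \notin s) \1_(A i) (Z i w).
Let mass s A := \prod_(i | i \notin s) fine (P (Z i @^-1` A i)).

Let mangle s : measurable_fun setT (angle s).
Proof. by apply: measurable_sum => i; exact: measurable_funM. Qed.

Let mevents s A : (forall i, measurable (A i)) -> measurable_fun setT (events s A).
Proof.
move=> mA; rewrite /events; under eq_fun do rewrite -big_filter.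
apply: measurable_prod => i _.
have mAi := mA i.
have mI : measurable_fun setT (\1_(A i) : R -> R) by exact: measurable_indic.
exact: (measurableT_comp mI (mZ i)).
Qed.

Let events_le1 s A w : `|events s A w| <= 1.
Proof.
rewrite /events; elim/big_ind : _ => [|x y x1 y1|i _]; rewrite ?normr1//.
  by rewrite normrM -[leRHS]mulr1 ler_pM.
by rewrite ger0_norm.
Qed.

Let E_events A : (forall i, measurable (A i)) ->
  \int[P]_w events [::] A w = mass [::] A.
Proof.
move=> mA.
have mZA i : measurable (Z i @^-1` A i) by have := mZ i measurableT (mA i); rewrite setTI.
have -> : mass [::] A = fine (P (\bigcap_(i in [set` [set: I]%SET]) (Z i @^-1` A i))).
  rewrite indep//; under [in RHS]eq_bigr => i _.
    rewrite -(@fineK _ (P (Z i @^-1` A i))) ?fin_num_measure//.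
    over.
  rewrite prodEFin /=; apply: eq_bigl => i.
  by rewrite finset.in_setT.
have mB : measurable (\bigcap_(i in [set` [set: I]%SET]) (Z i @^-1` A i)).
  by apply: fin_bigcap_measurable => //; exact: finite_finset.
have := integral_indic P measurableT mB; rewrite setIT => <-.
rewrite /Rintegral; congr fine; apply: eq_integral => w _; congr EFin.
rewrite /events indicE.
have [wA|/existsNP[i wA]] := pselect (forall i, A i (Z i w)).
  rewrite mem_set; last by move=> i _; exact: wA.
  by rewrite big1// => i _; rewrite indicE mem_set.
rewrite memNset; last by move/(_ i); rewrite /= finset.in_setT => /(_ isT).
by rewrite (bigD1 i)//= indicE memNset// mul0r.
Qed.

Let replace A i (D : set (measurableTypeR R)) j := if j == i then D else A j.

Let measurable_replace A (i : I) (D : set (measurableTypeR R)) :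
  (forall j, measurable (A j)) -> measurable D ->
  forall j, measurable (replace A i D j).
Proof. by move=> mA mD j; rewrite /replace; case: ifP. Qed.

Let notin_cons (i : I) s j : (j \notin s) && (j != i) = (j \notin i :: s).
Proof. by rewrite in_cons negb_or andbC. Qed.

Let events_replace s A i (D : set (measurableTypeR R)) w : i \notin s ->
  events s (replace A i D) w = \1_D (Z i w) * events (i :: s) A w.
Proof.
move=> si; rewrite /events (bigD1 i)//= {1}/replace eqxx; congr (_ * _).
apply: eq_big => j; first exact: notin_cons.
by move=> /andP[_ ji]; rewrite /replace (negbTE ji).
Qed.

Let mass_replace s A i (D : set (measurableTypeR R)) : i \notin s ->
  mass s (replace A i D) = fine (P (Z i @^-1` D)) * mass (i :: s) A.
Proof.
move=> si; rewrite /mass (bigD1 i)//= {1}/replace eqxx; congr (_ * _).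
apply: eq_big => j; first exact: notin_cons.
by move=> /andP[_ ji]; rewrite /replace (negbTE ji).
Qed.

Let mcos : measurable_fun setT (@cos R).
Proof. exact: continuous_measurable_fun (@continuous_cos R). Qed.

Let msin : measurable_fun setT (@sin R).
Proof. exact: continuous_measurable_fun (@continuous_sin R). Qed.

(** The induction hypothesis, used with an arbitrary event for Z_i, is exactly the
hypothesis of [decouple] for Z_i. *)
Let E_step s A i (f : R -> R) (F : R) (g : R -> R) :
  measurable_fun setT f -> (forall x, `|f x| <= 1) ->
  measurable_fun setT g -> (forall x, `|g x| <= 1) ->
  (forall j, measurable (A j)) -> i \notin s ->
  (forall B, (forall j, measurable (B j)) ->
    \int[P]_w (f (angle s w) * events s B w) = F * mass s B) ->
  \int[P]_w (f (angle s w) * g (c i * Z i w) * events (i :: s) A w) =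
  F * \int[P]_w g (c i * Z i w) * mass (i :: s) A.
Proof.
move=> mf f1 mg g1 mA si IH.
pose W w := f (angle s w) * events (i :: s) A w.
have mW : measurable_fun setT W.
  by apply: measurable_funM; [exact: (measurableT_comp mf)|exact: mevents].
have W1 w : `|W w| <= 1 by rewrite normrM -[leRHS]mulr1 ler_pM.
have WA (D : set (measurableTypeR R)) : measurable D ->
    \int[P]_w (W w * \1_D (Z i w)) = F * fine (P (Z i @^-1` D)) * mass (i :: s) A.
  move=> mD; have := IH _ (measurable_replace i mA mD).
  rewrite mass_replace// mulrA => <-.
  by apply: eq_Rintegral => w _; rewrite events_replace// /W; ring.
have EW : \int[P]_w W w = F * mass (i :: s) A.
  have := WA setT measurableT; rewrite preimage_setT probability_setT/= mulr1 => <-.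
  by apply: eq_Rintegral => w _; rewrite indicE mem_set// mulr1.
transitivity (\int[P]_w (W w * g (c i * Z i w))).
  by apply: eq_Rintegral => w _; rewrite /W; ring.
have mgc : measurable_fun setT (fun x => g (c i * x)).
  by apply: (measurableT_comp mg); exact: measurable_funM.
rewrite (@decouple _ _ _ P (Z i) (mZ i) W 1 (fun x => g (c i * x)) 1)//.
  by rewrite EW; ring.
by move=> D mD; rewrite WA// EW; ring.
Qed.

Let E_angle s : uniq s -> forall A, (forall j, measurable (A j)) ->
  \int[P]_w (cos (angle s w) * events s A w) =
    expR (\sum_(i <- s) a i) * cos (\sum_(i <- s) b i) * mass s A /\
  \int[P]_w (sin (angle s w) * events s A w) =
    expR (\sum_(i <- s) a i) * sin (\sum_(i <- s) b i) * mass s A.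
Proof.
elim: s => [_ A mA|i s IH /= /andP[si us] A mA].
  rewrite !big_nil expR0 cos0 sin0 !mul1r mul0r -E_events//; split.
    by apply: eq_Rintegral => w _; rewrite /angle big_nil cos0 mul1r.
  rewrite -[RHS](mul0r (fine (P setT))) -(Rintegral_cst P measurableT 0).
  by apply: eq_Rintegral => w _; rewrite /angle big_nil sin0 mul0r.
have ibd (f g : R -> R) : measurable_fun setT f -> (forall x, `|f x| <= 1) ->
    measurable_fun setT g -> (forall x, `|g x| <= 1) ->
    P.-integrable setT (EFin \o
      (fun w => f (angle s w) * g (c i * Z i w) * events (i :: s) A w)).
  move=> mf f1 mg g1; apply: (@integrable_le _ _ _ P _ (cst 1)).
  - apply: measurable_funM; last exact: mevents.
    apply: measurable_funM; first exact: (measurableT_comp mf).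
    by apply: (measurableT_comp mg); exact: measurable_funM.
  - by move=> w; rewrite !normrM -[leRHS]mulr1 ler_pM// -[leRHS]mulr1 ler_pM.
  - exact: finite_measure_integrable_cst.
have IHc B mB := (IH us B mB).1.
have IHs B mB := (IH us B mB).2.
have cm := @cos_max R; have sm := @sin_max R.
rewrite !big_cons expRD cosD sinD; split.
- transitivity (\int[P]_w (cos (angle s w) * cos (c i * Z i w) * events (i :: s) A w
      - sin (angle s w) * sin (c i * Z i w) * events (i :: s) A w)).
    by apply: eq_Rintegral => w _; rewrite /angle big_cons cosD; ring.
  rewrite RintegralB//; [|exact: ibd..].
  rewrite (E_step mcos cm mcos cm mA si IHc) (E_step msin sm msin sm mA si IHs).
  by rewrite EcosZ EsinZ; ring.
- transitivity (\int[P]_w (cos (angle s w) * sin (c i * Z i w) * events (i :: s) A w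
      + sin (angle s w) * cos (c i * Z i w) * events (i :: s) A w)).
    by apply: eq_Rintegral => w _; rewrite /angle big_cons sinD; ring.
  rewrite RintegralD//; [|exact: ibd..].
  rewrite (E_step mcos cm msin sm mA si IHc) (E_step msin sm mcos cm mA si IHs).
  by rewrite EcosZ EsinZ; ring.
Qed.

Lemma Ecos_sum_Esin_sum :
  \int[P]_w cos (\sum_i c i * Z i w) = expR (\sum_i a i) * cos (\sum_i b i) /\
  \int[P]_w sin (\sum_i c i * Z i w) = expR (\sum_i a i) * sin (\sum_i b i).
Proof.
have mT : forall i : I, measurable ((fun=> setT) i : set (measurableTypeR R)) by [].
have [] := E_angle (index_enum_uniq I) mT.
have -> : mass (index_enum I) (fun=> setT) = 1.
  by rewrite /mass big1// => i; rewrite mem_index_enum.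
rewrite !mulr1 => <- <-; split; apply: eq_Rintegral => w _;
  by rewrite /events [in RHS]big1 ?mulr1// => i; rewrite mem_index_enum.
Qed.

End independent_sum.

(** * The Levy-Khintchine integral *)

Section levy_khintchine.
Context (R : realType).
Local Notation leb := (@lebesgue_measure R).
Variables (k dens A B : R -> R).
Hypothesis mdens : measurable_fun setT dens.
Hypothesis dens_ge0 : forall u, 0 <= dens u.
Hypothesis densE : forall u, u * dens u = k u.
Hypothesis ik : leb.-integrable setT (EFin \o k).
Hypothesis dA : forall z : R, is_derive z 1 A (- \int[leb]_u (k u * sin (z * u))).
Hypothesis dB : forall z : R, is_derive z 1 B (\int[leb]_u (k u * cos (z * u))).
Hypothesis A0 : A 0 = 0.
Hypothesis B0 : B 0 = 0.

Let inormk : leb.-integrable setT (EFin \o (fun u => `|k u|)) := integrable_norm ik.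

Let normk u : `|k u| = `|u| * dens u.
Proof. by rewrite -densE normrM (ger0_norm (dens_ge0 u)). Qed.

Let eq_of_derive (F G F' : R -> R) : (forall z : R, is_derive z 1 F (F' z)) ->
  (forall z : R, is_derive z 1 G (F' z)) -> F 0 = G 0 -> F =1 G.
Proof.
move=> dF dG FG z.
have d0 (t : R) : is_derive t 1 (fun t => F t - G t) 0.
  by have ? := dF t; have ? := dG t; apply: is_derive_eq; rewrite subrr.
have /eqP := @is_derive_0_is_cst R (fun t => F t - G t) z 0 d0.
by rewrite FG subrr subr_eq0 => /eqP.
Qed.

Let icos z : leb.-integrable setT (EFin \o (fun u => (cos (z * u) - 1) * dens u)).
Proof.
apply: (@integrable_le _ (measurableTypeR R) R leb _ (fun u => `|z| * `|k u|)).
- by apply: measurable_funM => //; apply: measurable_funB => //; exact: measurable_cosM.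
- move=> u; rewrite normrM (ger0_norm (dens_ge0 u)) normk mulrA ler_wpM2r//.
  have := @norm_increment_le _ cos (fun x => - sin x) 1 0 (z * u) (@is_derive_cos R).
  rewrite cos0 subr0 mul1r normrM; apply => t.
  by rewrite normrN; exact: sin_max.
- exact: (integrableZl measurableT `|z| inormk).
Qed.

Let isin z : leb.-integrable setT (EFin \o (fun u => sin (z * u) * dens u)).
Proof.
apply: (@integrable_le _ (measurableTypeR R) R leb _ (fun u => `|z| * `|k u|)).
- by apply: measurable_funM => //; exact: measurable_sinM.
- move=> u; rewrite normrM (ger0_norm (dens_ge0 u)) normk mulrA ler_wpM2r//.
  by rewrite (le_trans (norm_sin_le _))// normrM.
- exact: (integrableZl measurableT `|z| inormk).
Qed.

(** Both sides have derivative - int k(u) sin(zu) du and vanish at 0. *)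
Lemma levy_log_modulus z : A z = \int[leb]_u ((cos (z * u) - 1) * dens u).
Proof.
have := @eq_of_derive A (fun z => \int[leb]_u ((cos (z * u) - 1) * dens u)) _ dA.
apply => [t|]; last first.
  rewrite A0; under eq_Rintegral do rewrite mul0r cos0 subrr mul0r.
  by rewrite Rintegral_cst// mul0r.
have -> : - (\int[leb]_u (k u * sin (t * u))) = \int[leb]_u (- (k u * sin (t * u))).
  rewrite -mulN1r -RintegralZl//; first by apply: eq_Rintegral => u _; rewrite mulN1r.
  by apply: (integrable_mul_bounded ik (measurable_sinM t) (C := 1)) => u; exact: sin_max.
apply: (@is_derive_Rintegral _ (measurableTypeR R) R leb
    (fun z u => (cos (z * u) - 1) * dens u)
    (fun z u => - (k u * sin (z * u))) (fun u => `|k u|) t icos) => //.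
- by move=> y u; apply: is_derive_eq; rewrite /GRing.scale/= -densE; ring.
- by move=> y u; rewrite normrN normrM ler_piMr// sin_max.
Qed.

Lemma levy_phase z : B z = \int[leb]_u (sin (z * u) * dens u).
Proof.
have := @eq_of_derive B (fun z => \int[leb]_u (sin (z * u) * dens u)) _ dB.
apply => [t|]; last first.
  rewrite B0; under eq_Rintegral do rewrite mul0r sin0 mul0r.
  by rewrite Rintegral_cst// mul0r.
apply: (@is_derive_Rintegral _ (measurableTypeR R) R leb (fun z u => sin (z * u) * dens u)
    (fun z u => k u * cos (z * u)) (fun u => `|k u|) t isin) => //.
- by move=> y u; apply: is_derive_eq; rewrite /GRing.scale/= -densE; ring.
- by move=> y u; rewrite normrM ler_piMr// cos_max.
Qed.

(** As u dens(u) = k(u) is integrable near 0, the compensator can be split off; it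
becomes a drift. *)
Lemma levy_phase_compensated z :
  \int[leb]_u ((sin (z * u) - z * u * \1_(`[-1, 1] : set R) u) * dens u) =
  B z - z * \int[leb]_u (k u * \1_(`[-1, 1] : set R) u).
Proof.
have ik1 : leb.-integrable setT (fun u => (k u * \1_(`[-1, 1] : set R) u)%:E).
  apply: (integrable_mul_bounded ik _ (C := 1)) => // u.
  by rewrite ger0_norm.
rewrite levy_phase -RintegralZl// -RintegralB//.
  by apply: eq_Rintegral => u _; rewrite -densE; ring.
exact: (integrableZl measurableT z ik1).
Qed.

Lemma levy_min_integral :
  (\int[leb]_u (Num.min 1 (u ^+ 2) * dens u)%:E < +oo)%E.
Proof.
have imin : leb.-integrable setT (EFin \o (fun u => Num.min 1 (u ^+ 2) * dens u)).
  apply: (integrable_le _ _ inormk).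
  - by apply: measurable_funM => //; apply: measurable_minr => //; exact: measurable_funX.
  - move=> u; rewrite normk normrM (ger0_norm (dens_ge0 u)) ler_wpM2r//.
    rewrite ger0_norm ?le_min ?ler01 ?sqr_ge0// ge_min.
    have [u1|u1] := leP 1 `|u|; first by [].
    rewrite -(real_normK (num_real u)) expr2 ler_piMr ?orbT//.
    exact: ltW.
exact: (integrable_lty measurableT imin).
Qed.

End levy_khintchine.

(** * Schwartz functions are bounded and integrable *)

Section schwartz_bound.
Context (R : realType).
Local Notation leb := (@lebesgue_measure R).

Lemma schwartz_continuous (f : R -> R) : schwartz f -> continuous f.
Proof.
by move=> [df _] x; apply/differentiable_continuous/derivable1_diffP; exact: (df 0%N x).
Qed.

(** Far out x^2 |f| is at most 1, and on the remaining segment f is bounded by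
continuity. *)
Lemma schwartz_cauchy_bound (f : R -> R) : schwartz f ->
  exists C, forall x, `|f x| <= C * cauchy_fun x.
Proof.
move=> sf; have cf := schwartz_continuous sf; have [_ /(_ 2 0%N)[/= fy fNy]] := sf.
have /cvgrPdist_le/(_ 1 ltr01)[My [_ fMy]] := fy.
have /cvgrPdist_le/(_ 1 ltr01)[Mn [_ fMn]] := fNy.
pose M := `|My| + `|Mn| + 1.
have MM : - M <= M by rewrite /M; have := normr_ge0 My; have := normr_ge0 Mn; lra.
have cnf : continuous (fun x => `|f x|).
  by move=> x; apply: cvg_norm; exact: cf.
have [c _ fc] := @EVT_max R (fun x => `|f x|) _ _ MM (continuous_subspaceT cnf).
exists (`|f c| * (1 + M ^+ 2) + 2) => x.
rewrite /cauchy_fun ler_pdivlMr ?cauchy_denom_gt0//.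
have [xM|xM] := leP `|x| M.
  rewrite (@le_trans _ _ (`|f c| * (1 + M ^+ 2)))//; last by rewrite lerDl.
  apply: ler_pM => //; first by rewrite ltW// cauchy_denom_gt0.
    by apply: fc; rewrite in_itv/= -ler_norml.
  by rewrite lerD2l -(real_normK (num_real x)) ler_pXn2r// nnegrE (le_trans _ xM).
have x2f : `|x ^+ 2 * f x| <= 1.
  have [x0|x0] := leP 0 x.
    have := fMy x; rewrite sub0r normrN normr_id; apply.
    move: xM; rewrite ger0_norm// /M; have := ler_norm My; have := normr_ge0 Mn; lra.
  have := fMn x; rewrite sub0r normrN normr_id; apply.
  move: xM; rewrite ltr0_norm// /M; have := ler_normr Mn (- Mn); have := normr_ge0 My.
  by have := ler_norm (- Mn); rewrite normrN; lra.
have M1 : 1 <= M by rewrite /M; have := normr_ge0 My; have := normr_ge0 Mn; lra.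
have x1 : 1 <= x ^+ 2.
  by rewrite -(real_normK (num_real x)) expr_ge1//; lra.
move: x2f; rewrite normrM ger0_norm ?sqr_ge0// => x2f.
have fx1 : `|f x| <= x ^+ 2 * `|f x| by rewrite ler_peMl.
rewrite (@le_trans _ _ 2)//; first by rewrite mulrDr mulr1; lra.
by rewrite lerDr mulr_ge0 ?addr_ge0 ?sqr_ge0.
Qed.

Lemma schwartz_bounded_integrable (f : R -> R) : schwartz f ->
  (exists C, forall x, `|f x| <= C) /\ leb.-integrable setT (EFin \o f).
Proof.
move=> sf; have [C fC] := schwartz_cauchy_bound sf.
have C0 : 0 <= C.
  have := le_trans (normr_ge0 _) (fC 0).
  by rewrite /cauchy_fun expr0n addr0 invr1 mulr1.
split.
  exists C => x; rewrite (le_trans (fC x))// ler_piMr// /cauchy_fun.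
  by rewrite invf_le1 ?cauchy_denom_gt0// lerDl sqr_ge0.
apply: (@integrable_le _ (measurableTypeR R) R leb f (fun x => C * cauchy_fun x)) => //.
  exact: (continuous_measurable_fun (schwartz_continuous sf)).
exact: (integrableZl measurableT C (@integrable_cauchy R)).
Qed.

End schwartz_bound.

(** * The exponent of a weighted sum of gamma variables *)

Section gamma_law.
Context d (Omega : measurableType d) (R : realType) (P : probability Omega R).
Local Notation leb := (@lebesgue_measure R).

Lemma charfunE (X : Omega -> R) (z : R) : charfun P X z =
  Complex (\int[P]_w cos (z * X w)) (\int[P]_w sin (z * X w)).
Proof.
by rewrite /charfun /cintegral; congr Complex; apply: eq_Rintegral => w _;
  rewrite /= expR0 mul1r.
Qed.

Lemma gamma_law_trig (X : Omega -> R) (a s c z : R) : 0 < a -> c != 0 ->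
  has_gamma_law P X a s ->
  \int[P]_w cos (z * c * X w) =
    expR (log_modulus s (a / c) z) * cos (phase s (a / c) z) /\
  \int[P]_w sin (z * c * X w) =
    expR (log_modulus s (a / c) z) * sin (phase s (a / c) z).
Proof.
move=> a0 c0 /(_ (z * c)); rewrite charfunE /cpowR /cexp /clog /= => -[-> ->].
have -> : z * c / a = z / (a / c) by field; rewrite c0 gt_eqF.
rewrite !mul0r addr0 subr0 expr1n sqrrN divr1 atanN mulrNN.
by split.
Qed.

End gamma_law.

Section gamma_exponent_sum.
Context (R : realType) (I : finType) (s b : I -> R).
Hypothesis s_ge0 : forall i, 0 <= s i.
Hypothesis b_neq0 : forall i, b i != 0.
Local Notation leb := (@lebesgue_measure R).

Definition signed_half_exp_sum (u : R) : R := \sum_i s i * signed_half_exp (b i) u.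

Let integrable_term i :
  leb.-integrable setT (EFin \o (fun u => s i * signed_half_exp (b i) u)).
Proof.
exact: (integrableZl measurableT (s i) (integrable_signed_half_exp (b_neq0 i))).
Qed.

Lemma integrable_signed_half_exp_sum : leb.-integrable setT (EFin \o signed_half_exp_sum).
Proof. exact: integrable_sumR. Qed.

Let signed_half_exp_sum_transform (g : R -> R) (F : I -> R) : measurable_fun setT g ->
  (forall x, `|g x| <= 1) ->
  (forall i, \int[leb]_u (signed_half_exp (b i) u * g u) = F i) ->
  \int[leb]_u (signed_half_exp_sum u * g u) = \sum_i s i * F i.
Proof.
move=> mg g1 gF.
have ig i : leb.-integrable setT (fun u => (signed_half_exp (b i) u * g u)%:E).
  exact: (integrable_mul_bounded (integrable_signed_half_exp (b_neq0 i)) mg g1).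
transitivity (\int[leb]_u (\sum_i s i * (signed_half_exp (b i) u * g u))).
  apply: eq_Rintegral => u _; rewrite /signed_half_exp_sum mulr_suml.
  by apply: eq_bigr => i _; rewrite mulrA.
rewrite Rintegral_sum => [|i]; last exact: (integrableZl measurableT (s i) (ig i)).
by apply: eq_bigr => i _; rewrite RintegralZl; [congr (_ * _); exact: gF|by []|exact: ig].
Qed.

Let is_derive_bigsum (F : I -> R -> R) (F' : I -> R) (z : R) :
  (forall i, is_derive z 1 (F i) (F' i)) ->
  is_derive z 1 (fun z => \sum_i F i z) (\sum_i F' i).
Proof.
move=> dF; elim: (index_enum I) => [|i r IH].
  rewrite big_nil (_ : (fun _ => _) = cst 0)//.
    exact: is_derive_cst.
  by apply/funext => y; rewrite big_nil.
rewrite big_cons (_ : (fun _ => _) = (fun y => F i y + \sum_(j <- r) F j y)).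
  have ? := dF i; exact: is_deriveD.
by apply/funext => y; rewrite big_cons.
Qed.

Lemma is_derive_log_modulus_sum (z : R) :
  is_derive z 1 (fun z => \sum_i log_modulus (s i) (b i) z)
    (- \int[leb]_u (signed_half_exp_sum u * sin (z * u))).
Proof.
rewrite (signed_half_exp_sum_transform (measurable_sinM z)
  (fun u => sin_max _) (fun i => signed_half_exp_sin z (b_neq0 i))).
rewrite -sumrN; apply: is_derive_bigsum => i; rewrite -mulNr.
exact: is_derive_log_modulus.
Qed.

Lemma is_derive_phase_sum (z : R) :
  is_derive z 1 (fun z => \sum_i phase (s i) (b i) z)
    (\int[leb]_u (signed_half_exp_sum u * cos (z * u))).
Proof.
rewrite (signed_half_exp_sum_transform (measurable_cosM z)
  (fun u => cos_max _) (fun i => signed_half_exp_cos z (b_neq0 i))).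
by apply: is_derive_bigsum => i; exact: is_derive_phase.
Qed.

Lemma log_modulus_sum_le0 z : \sum_i log_modulus (s i) (b i) z <= 0.
Proof. by apply: sumr_le0 => i _; exact: log_modulus_le0. Qed.

Lemma log_modulus_sum_ge z :
  - ((\sum_i s i / 2 / b i ^+ 2) * z ^+ 2) <= \sum_i log_modulus (s i) (b i) z.
Proof.
rewrite mulr_suml -sumrN; apply: ler_sum => i _.
by rewrite -mulNr; exact: log_modulus_ge.
Qed.

Lemma log_modulus_sum0 : \sum_i log_modulus (s i) (b i) 0 = 0.
Proof. by apply: big1 => i _; exact: log_modulus0. Qed.

Lemma phase_sum0 : \sum_i phase (s i) (b i) 0 = 0.
Proof. by apply: big1 => i _; exact: phase0. Qed.

End gamma_exponent_sum.

(** * The Levy measure and the Stein identity *)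

Lemma measurable_funV (R : realType) : measurable_fun setT (fun u : R => u^-1).
Proof.
have mV (D : set R) : open D -> ~ D 0 -> measurable_fun D (fun u : R => u^-1).
  move=> oD D0; apply: open_continuous_measurable_fun => // u.
  rewrite inE => Du; apply: inv_continuous.
  by apply: contra_notN D0 => /eqP <-.
have -> : [set: R] = (`]-oo, 0[ `|` [set 0]) `|` `]0, +oo[.
  apply/esym/seteqP; split => // u _ /=; rewrite !in_itv/= andbT.
  by case: (ltgtP u 0) => ?; [left; left|right|left; right].
apply/measurable_funU => //; first exact: measurableU.
split; last by apply: mV => /=; [exact: rray_open|rewrite in_itv/= ltxx].
apply/measurable_funU => //; split; last exact: measurable_fun_set1.
by apply: mV => /=; [exact: lray_open|rewrite in_itv/= ltxx].
Qed.

Section levy_density_facts.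
Context (R : realType) (n : nat).
Variables (alpha p beta q w1 w2 : 'I_n -> R).
Hypothesis halpha : forall j, 0 < alpha j.
Hypothesis hp : forall j, 0 < p j.
Hypothesis hbeta : forall j, 0 < beta j.
Hypothesis hq : forall j, 0 < q j.
Hypothesis hw1 : forall j, 0 < w1 j.
Hypothesis hw2 : forall j, 0 < w2 j.

Definition shape (i : ('I_n + 'I_n)%type) : R :=
  match i with inl j => p j | inr j => q j end.
Definition signed_rate (i : ('I_n + 'I_n)%type) : R :=
  match i with inl j => alpha j / w1 j | inr j => beta j / - w2 j end.

Lemma shape_ge0 i : 0 <= shape i.
Proof. by case: i => j; rewrite ltW /=. Qed.

Lemma signed_rate_neq0 i : signed_rate i != 0.
Proof. by case: i => j /=; rewrite mulf_neq0 ?invr_eq0 ?oppr_eq0 ?gt_eqF. Qed.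

Local Notation jump := (signed_half_exp_sum shape signed_rate).
Local Notation dens := (levy_density alpha p beta q w1 w2).

Lemma levy_densityE u : dens u = u^-1 * jump u.
Proof.
rewrite /levy_density /signed_half_exp_sum big_sumType/= -big_split/=; congr (_ * _).
apply: eq_bigr => j _ /=; rewrite /signed_half_exp divr_gt0//.
have bw : 0 < beta j / w2 j by rewrite divr_gt0.
have -> : beta j / - w2 j = - (beta j / w2 j) by rewrite invrN mulrN.
rewrite oppr_gt0 ltNge (ltW bw)/= opprK /half_exp mulrN; congr (_ - _).
  by rewrite -mulrA (mulrAC (alpha j)).
rewrite !indicE !mem_setE !in_itv/= andbT oppr_gt0 -mulrA.
have [u0|u0] := ltP u 0; last by rewrite !mulr0.
by rewrite ltr0_norm// (mulrAC (beta j)).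
Qed.

Lemma levy_density_mul u : u * dens u = jump u.
Proof.
have [->|u0] := eqVneq u 0; last by rewrite levy_densityE mulVKf.
rewrite mul0r /signed_half_exp_sum big1// => i _; rewrite /signed_half_exp oppr0.
by case: ifP; rewrite half_exp0 ?oppr0 mulr0.
Qed.

Lemma levy_density_ge0 u : 0 <= dens u.
Proof.
rewrite levy_densityE; have [u0|u0|->] := ltgtP u 0; last by rewrite invr0 mul0r.
- rewrite nmulr_rge0 ?invr_lt0//; apply: sumr_le0 => i _.
  rewrite mulr_ge0_le0 ?shape_ge0// /signed_half_exp; case: ifP => _.
    by rewrite /half_exp indicE mem_setE in_itv/= andbT ltNge (ltW u0) mulr0.
  by rewrite oppr_le0 half_exp_ge0.
- rewrite mulr_ge0 ?invr_ge0 ?(ltW u0)//; apply: sumr_ge0 => i _.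
  rewrite mulr_ge0 ?shape_ge0// /signed_half_exp.
  case: ifP => _; first exact: half_exp_ge0.
  by rewrite /half_exp indicE mem_setE in_itv/= andbT oppr_gt0 ltNge (ltW u0) mulr0 oppr0.
Qed.

Lemma measurable_levy_density : measurable_fun setT dens.
Proof.
rewrite (_ : dens = (fun u => u^-1 * jump u)); last exact/funext/levy_densityE.
apply: measurable_funM; first exact: measurable_funV.
have := integrable_signed_half_exp_sum shape signed_rate_neq0.
by move=> /(measurable_int _)/measurable_EFinP.
Qed.

End levy_density_facts.

Theorem proposition3p5 (R : realType) (d : measure_display)
    (Omega : measurableType d) (P : probability Omega R)
    (n : nat) (hn : (1 <= n)%N)
    (alpha p beta q w1 w2 : 'I_n -> R)
    (halpha : forall j, 0 < alpha j) (hp : forall j, 0 < p j)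
    (hbeta : forall j, 0 < beta j) (hq : forall j, 0 < q j)
    (hw1 : forall j, 0 < w1 j) (hw2 : forall j, 0 < w2 j)
    (X Y : 'I_n -> {RV P >-> R})
    (hindep : mutually_independent P
       (fun i : ('I_n + 'I_n)%type =>
          match i with inl j => X j : Omega -> R | inr j => Y j : Omega -> R end))
    (hX : forall j, has_gamma_law P (X j) (alpha j) (p j))
    (hY : forall j, has_gamma_law P (Y j) (beta j) (q j)) :
  let T : Omega -> R :=
    fun w => \sum_(j < n) (w1 j * X j w - w2 j * Y j w) in
  exists nu : {measure set (measurableTypeR R) -> \bar R},
    [/\ forall A : set (measurableTypeR R), measurable A ->
          nu A = (\int[lebesgue_measure]_(u in A)
                    (levy_density alpha p beta q w1 w2 u)%:E)%E,
        is_levy_measure P T nu &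
        forall f : R -> R, schwartz f ->
          (\int[P]_w ((T w * f (T w))%:E
                      - \int[nu]_u (u * f (T w + u))%:E) = 0)%E].
Proof.
move=> T.
pose s := shape p q; pose b := signed_rate alpha beta w1 w2.
have s0 : forall i, 0 <= s i := shape_ge0 hp hq.
have b0 : forall i, b i != 0 := signed_rate_neq0 halpha hbeta hw1 hw2.
pose Z (i : ('I_n + 'I_n)%type) : Omega -> R :=
  match i with inl j => X j : Omega -> R | inr j => Y j : Omega -> R end.
pose c (i : ('I_n + 'I_n)%type) : R := match i with inl j => w1 j | inr j => - w2 j end.
pose A z := \sum_i log_modulus (s i) (b i) z.
pose B z := \sum_i phase (s i) (b i) z.
pose k := signed_half_exp_sum s b; pose dens := levy_density alpha p beta q w1 w2.
have mZ i : measurable_fun setT (Z i) by case: i => j; exact: measurable_funPT.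
have TE w : T w = \sum_i c i * Z i w.
  by rewrite big_sumType/= -big_split/=; apply: eq_bigr => j _; rewrite mulNr.
have mT : measurable_fun setT T.
  rewrite (_ : T = (fun w => \sum_i c i * Z i w)); last exact/funext/TE.
  by apply: measurable_sum => i; exact: measurable_funM.
have trigZ z i : \int[P]_w cos (z * c i * Z i w) =
      expR (log_modulus (s i) (b i) z) * cos (phase (s i) (b i) z) /\
    \int[P]_w sin (z * c i * Z i w) =
      expR (log_modulus (s i) (b i) z) * sin (phase (s i) (b i) z).
  case: i => j; apply: gamma_law_trig => //.
  - by rewrite /c gt_eqF /=.
  - exact: hX.
  - by rewrite /c oppr_eq0 gt_eqF.
  - exact: hY.
have trigT z := Ecos_sum_Esin_sum mZ hindep
  (fun i => (trigZ z i).1) (fun i => (trigZ z i).2).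
have zT z w : z * T w = \sum_i z * c i * Z i w.
  by rewrite TE mulr_sumr; apply: eq_bigr => i _; rewrite mulrA.
have EcosT z : \int[P]_w cos (z * T w) = expR (A z) * cos (B z).
  by rewrite -(trigT z).1; apply: eq_Rintegral => w _; rewrite zT.
have EsinT z : \int[P]_w sin (z * T w) = expR (A z) * sin (B z).
  by rewrite -(trigT z).2; apply: eq_Rintegral => w _; rewrite zT.
have ik := integrable_signed_half_exp_sum s b0.
have dA := is_derive_log_modulus_sum s b0.
have dB := is_derive_phase_sum s b0.
have dens0 : forall u, 0 <= dens u := levy_density_ge0 halpha hp hbeta hq hw1 hw2.
have mdens : measurable_fun setT dens := measurable_levy_density p q halpha hbeta hw1 hw2.
have densE : forall u, u * dens u = k u := levy_density_mul p q halpha hbeta hw1 hw2.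
have A0 := log_modulus_sum0 s b.
have B0 := phase_sum0 s b.
have AE z : A z = \int[lebesgue_measure]_u ((cos (z * u) - 1) * dens u).
  exact: (levy_log_modulus mdens dens0 densE ik dA A0).
have BE z : \int[lebesgue_measure]_u
      ((sin (z * u) - z * u * \1_(`[-1, 1] : set R) u) * dens u) =
    B z - z * \int[lebesgue_measure]_u (k u * \1_(`[-1, 1] : set R) u).
  exact: (levy_phase_compensated mdens dens0 densE ik dB B0).
have [nu [nuE nuint]] := @density_measure_exists _ (measurableTypeR R) R
  lebesgue_measure dens dens0 mdens.
have nuR (g : R -> R) : measurable_fun setT g ->
    Rintegral nu setT g = \int[lebesgue_measure]_u (g u * dens u).
  by move=> mg; rewrite /Rintegral nuint.
exists nu; split; first exact: nuE.
- split.
  + by rewrite nuE// integral_set1.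
  + rewrite nuint; last by apply: measurable_minr => //; exact: measurable_funX.
    exact: levy_min_integral mdens dens0 densE ik.
  (* the drift undoes the truncated compensator; there is no Gaussian part *)
  + exists (\int[lebesgue_measure]_u (k u * \1_(`[-1, 1] : set R) u)), 0 => z.
    rewrite charfunE EcosT EsinT.
    set I := cintegral _ _.
    have -> : I = Complex (A z)
        (B z - z * \int[lebesgue_measure]_u (k u * \1_(`[-1, 1] : set R) u)).
      rewrite /I /cintegral; congr Complex.
      * rewrite AE -nuR; last first.
          by apply: measurable_funB => //; exact: measurable_cosM.
        by apply: eq_Rintegral => u _; rewrite /= expR0 mul1r subr0.
      * rewrite -BE -nuR; last first.
          apply: measurable_funB; first exact: measurable_sinM.
          by apply: measurable_funM => //; exact: measurable_funM.
        by apply: eq_Rintegral => u _; rewrite /= expR0 mul1r subr0.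
    rewrite /cexp /=; congr Complex; congr (expR _ * _).
    - by rewrite expr0n mul0r mul0r oppr0 add0r.
    - by congr cos; ring.
    - by rewrite expr0n mul0r mul0r oppr0 add0r.
    - by congr sin; ring.
- move=> f sf; have cf := schwartz_continuous sf.
  have [[C fC] if_] := schwartz_bounded_integrable sf.
  have mf := continuous_measurable_fun cf.
  have iT := integrable_of_exponent mT ik dB (log_modulus_sum_le0 b s0)
    (log_modulus_sum_ge b s0) B0 EcosT.
  have ST := stein_identity mT ik dA dB (log_modulus_sum_le0 b s0)
    (log_modulus_sum_ge b s0) B0 EcosT EsinT cf fC if_.
  have iTf : P.-integrable setT (EFin \o (fun w => T w * f (T w))).
    apply: (integrable_mul_bounded iT _ (C := C)) => //.
    exact: (measurableT_comp mf).
  have ikf := integrable_translate P mT ik mf fC.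
  have nuf w : (\int[nu]_u (u * f (T w + u))%:E)%E =
      (\int[lebesgue_measure]_u (k u * f (T w + u)))%:E.
    have mfw : measurable_fun setT (fun u => f (T w + u)).
      by apply: (measurableT_comp mf); exact: measurable_funD.
    rewrite nuint; last exact: measurable_funM.
    rewrite EFin_Rintegral; last first.
      exact: (integrable_mul_bounded ik mfw (C := C)).
    by apply: eq_integral => u _; rewrite -densE; congr EFin; ring.
  under eq_integral do rewrite nuf -EFinB.
  rewrite -EFin_Rintegral; last exact: (integrableB measurableT iTf ikf).
  by rewrite RintegralB// ST subrr.
Qed.
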